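(* Every reflexive quojection is an Asplund space.
   Context: All vector spaces are real; all topological vector spaces are Hausdorff; ''lcs'' means locally convex space. A lcs $E$ is Asplund if every continuous convex function $f:D\to\mathbb{R}$, where $D\subset E$ is a nonempty open convex set, is Fréchet differentiable on a dense $G_\delta$ subset of $D$. Here $f$ is Fréchet differentiable at $x\in D$ if there is $x^*\in E'$ with $\lim_{t\to0}\frac{f(x+ty)-f(x)}{t}=x^*(y)$ uniformly for $y$ in each bounded subset of $E$. Let $(E_n)_n$ be a sequence of Banach spaces and, for $m\ge n$, let $P_{nm}:E_m\to E_n$ be continuous linear maps with $P_{nn}$ the identity and $P_{nm}\circ P_{ms}=P_{ns}$ for $s\ge m\ge n$. The projective limit is $E=\{(x(n))\in\prod_nE_n: P_{nm}(x(m))=x(n),\ m\ge n\}$ with the product topology, and the canonical projections are $P_n:E\to E_n$, $(x(m))_m\mapsto x(n)$. $E$ is a strict projective limit of $(E_n)_n$ if each $P_n$ is surjective. A quojection is a Fréchet space (metrizable and complete lcs) that is the strict projective limit of such a sequence of Banach spaces. Reflexive means reflexive as a lcs (the canonical map into the strong bidual is a topological isomorphism onto). *)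

(* Defs.v *)
From HB Require Import structures.
From mathcomp Require Import all_boot all_order all_algebra.
From mathcomp Require Import all_classical all_reals all_analysis.
From mathcomp Require Import borel_hierarchy.

Set Implicit Arguments.
Unset Strict Implicit.
Unset Printing Implicit Defensive.

Import Order.TTheory GRing.Theory Num.Theory.
Import numFieldNormedType.Exports.

Local Open Scope classical_set_scope.
Local Open Scope ring_scope.

(* [tvsType R] is the class of locally convex spaces over R; it does not       *)
(* include the Hausdorff axiom, which is stated in [frechet_space].            *)

Definition homeomorphism_onto (T U : topologicalType) (D : set U) (f : T -> U) :=
  continuous f /\
  exists g : U -> T,
    [/\ cancel f g, range f `<=` D, forall y, D y -> f (g y) = y
      & {within D, continuous g}].

(* von Neumann boundedness; the library's [bounded_set] is about norms *)
Definition tvs_bounded (R : realType) (E : preTopologicalLmodType R)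
    (B : set E) :=
  forall U : set E, nbhs 0 U ->
    \forall t \near +oo, B `<=` [set t *: x | x in U].

Section strong_dual.
Context {R : realType} {E : preTopologicalLmodType R}.

Definition continuous_linear_form : {pred (E -> R^o)} :=
  fun f => `[< linear f /\ continuous f >].

Lemma continuous_linear_form_submod : submod_closed continuous_linear_form.
Proof.
split=> [|a f g /asboolP[lf cf] /asboolP[lg cg]]; apply/asboolP; split.
- by move=> b x y; rewrite scaler0 addr0.
- by move=> x; exact: cvg_cst.
- move=> b x y; rewrite !fctE lf lg.
  by rewrite !scalerDr !scalerA mulrC addrACA.
- move=> x; apply: cvgD; last exact: cg.
  by apply: cvgZl_tmp; exact: cf.
Qed.

HB.instance Definition _ := GRing.isSubmodClosed.Build R (E -> R^o)
  continuous_linear_form continuous_linear_form_submod.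

End strong_dual.

Record strong_dual (R : realType) (E : preTopologicalLmodType R) := StrongDual {
  dual_fun :> E -> R^o;
  dual_funP : dual_fun \in continuous_linear_form }.

Section strong_dual_structure.
Context {R : realType} {E : preTopologicalLmodType R}.

HB.instance Definition _ := [isSub for @dual_fun R E].
HB.instance Definition _ := [Choice of strong_dual E by <:].
HB.instance Definition _ := [SubChoice_isSubLmodule of strong_dual E by <:].

(* strong topology: uniform convergence on the bounded subsets of E *)
HB.instance Definition _ := Uniform.copy (strong_dual E)
  (initial_topology
    (@dual_fun R E : strong_dual E -> {family @tvs_bounded R E, E -> R^o})).

End strong_dual_structure.

Section evaluation.
Context {R : realType} {E : tvsType R}.

Lemma tvs_bounded1 (x : E) : tvs_bounded [set x].
Proof.
move=> U U0.
have /= := @scale_continuous R E (0, x) U.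
rewrite scale0r => /(_ U0)[[/= V W] [V0 Wx] VWU].
have /nbhs_ballP[e /= e0 eV] := V0.
near=> t => y -> /=.
have t0 : 0 < t by near: t; exact: nbhs_pinfty_gt.
exists (t^-1 *: x); last by rewrite scalerA divff ?scale1r// gt_eqF.
apply: (VWU (t^-1, x)); split; last exact: nbhs_singleton.
apply: eV; rewrite -ball_normE /= sub0r normrN gtr0_norm ?invr_gt0//.
rewrite invf_plt ?posrE//.
by near: t; apply: nbhs_pinfty_gt; exact: num_real.
Unshelve. all: by end_near. Qed.

Lemma bidual_eval_subproof (x : E) :
  (fun f : strong_dual E => f x) \in @continuous_linear_form R (strong_dual E).
Proof.
apply/asboolP; split=> // f.
have fcvg : {family @tvs_bounded R E,
    (@dual_fun R E) @ nbhs f --> (f : E -> R^o)}.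
  exact: (@initial_continuous _ _
    (@dual_fun R E : strong_dual E -> {family @tvs_bounded R E, E -> R^o})).
have [+ _] := @fam_cvgP E R^o (@tvs_bounded R E) _ (f : E -> R^o)
  (fmap_filter (@dual_fun R E) (nbhs_filter f)).
by move=> /(_ fcvg _ (tvs_bounded1 x)); rewrite uniform_set1.
Qed.

Definition bidual_eval (x : E) : strong_dual (strong_dual E) :=
  StrongDual (bidual_eval_subproof x).

End evaluation.

Definition reflexive_lcs (R : realType) (E : tvsType R) :=
  homeomorphism_onto [set: strong_dual (strong_dual E)] (@bidual_eval R E).

Section asplund.
Context {R : realType} {E : tvsType R}.

(* [f] is only relevant on a neighbourhood of [x]: on a bounded set of [y]'s,  *)
(* [x + t *: y] eventually stays in any such neighbourhood as t -> 0.          *)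
Definition frechet_differentiable (f : E -> R^o) (x : E) :=
  exists x' : strong_dual E, forall B : set E, tvs_bounded B ->
    {uniform B, (fun (t : R) (y : E) => (f (x + t *: y) - f x) / t) @ 0^'
       --> (x' : E -> R^o)}.

End asplund.

Definition asplund (R : realType) (E : tvsType R) :=
  forall (D : set E) (f : E -> R^o),
    D !=set0 -> open D -> convex_set D ->
    {within D, continuous f} -> convex_function D f ->
    exists G : set E,
      [/\ Gdelta G, G `<=` D, D `<=` closure G
        & forall x, G x -> frechet_differentiable f x].

Definition metrizable (R : realType) (T : topologicalType) :=
  exists (M : metricType R) (h : T -> M), homeomorphism_onto setT h.

(* The uniformity carried by a [tvsType] need not be the translation-invariant *)
(* one, so Cauchy filters are taken with respect to the group structure.       *)
Definition tvs_cauchy (R : realType) (E : tvsType R) (F : set_system E) :=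
  forall U : set E, nbhs 0 U ->
    exists2 A, F A & forall x y, A x -> A y -> U (x - y).

Definition tvs_complete (R : realType) (E : tvsType R) :=
  forall F : set_system E, ProperFilter F -> tvs_cauchy F ->
    exists x : E, F --> x.

Definition frechet_space (R : realType) (E : tvsType R) :=
  [/\ hausdorff_space E, metrizable R E & tvs_complete E].

Section projective_limit.
Context {R : realType} (En : nat -> completeNormedModType R).
(* only the maps [P n m] with n <= m are meaningful *)
Context (P : forall n m, {linear En m -> En n}).

Definition projective_spectrum :=
  [/\ forall n m, (n <= m)%N -> continuous (P n m),
      forall n x, P n n x = x
    & forall n m s, (n <= m)%N -> (m <= s)%N ->
        forall x, P n m (P m s x) = P n s x].

Definition projective_limit : set (prod_topology En) :=
  [set x | forall n m, (n <= m)%N -> P n m (x m) = x n].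

Definition strict_projective_limit :=
  forall n, set_surj projective_limit setT (fun x => x n).

End projective_limit.

(* [E] is identified with the projective limit, which carries the subspace     *)
(* topology and the componentwise operations, by a topological isomorphism J.  *)
Definition quojection (R : realType) (E : tvsType R) :=
  frechet_space E /\
  exists (En : nat -> completeNormedModType R)
         (P : forall n m, {linear En m -> En n})
         (J : E -> prod_topology En),
    [/\ projective_spectrum P, strict_projective_limit P,
        forall n, linear (fun x => J x n)
      & homeomorphism_onto (projective_limit P) J].

(* Main.v *)
(* A reflexive quojection has a fundamental sequence of complete seminorms p_n,
   and the open mapping theorem along the projective spectrum lifts the p_n-unit
   ball to a bounded set of E.

   By Hahn-Banach in the strong dual and reflexivity, the functionals bounded by
   p_n are separable for uniform convergence on any countable bounded set: a
   functional on the dual that vanishes on countably many norming functionals is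
   an evaluation at a point where all seminorms vanish.

   A continuous convex function f is locally bounded for some p_n, hence locally
   p_n-Lipschitz.  If its symmetric second differences were large at every point
   of a ball, one could follow a branch of a countable tree of points to a limit
   whose subgradient avoids the whole countable dense family (the argument of
   Preiss and Zajicek).  Baire's argument then gives a point where the second
   differences are o(p_n), which for a convex function is differentiability
   uniformly on p_n-bounded sets, hence on bounded ones.  The points of different
   levels n are kept apart by disjoint open sets, so that the good points form a
   G_delta. *)

Require Import Defs.
From mathcomp Require Import all_boot all_order all_algebra.
From mathcomp Require Import all_classical all_reals all_analysis.
From mathcomp Require Import borel_hierarchy ring lra.

Set Implicit Arguments.
Unset Strict Implicit.
Unset Printing Implicit Defensive.

Import Order.TTheory GRing.Theory Num.Theory.
Import numFieldNormedType.Exports.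

Local Open Scope classical_set_scope.
Local Open Scope ring_scope.

(** * Hahn-Banach *)

Section hahn_banach.
Context {R : realType} {V : lmodType R}.
Implicit Types (p q : V -> R) (x y : V) (a t m : R).

Definition sublinear q :=
  (forall x y, q (x + y) <= q x + q y) /\
  (forall a x, 0 < a -> q (a *: x) <= a * q x).

Lemma sublinearZ q a x : sublinear q -> 0 <= a -> q (a *: x) = a * q x.
Proof.
move=> [qD qZ]; rewrite le_eqVlt => /predU1P[<-|a0]; last first.
  apply/eqP; rewrite eq_le qZ//= -ler_pdivlMl//.
  by rewrite -[leLHS]/(q x) -{1}[x](scalerK (lt0r_neq0 a0)) qZ// invr_gt0.
rewrite scale0r mul0r.
(* The factors 2 and 1/2 give [q 0 <= 2 * q 0] and [q 0 <= q 0 / 2], whence [q 0 = 0]. *)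
have := qZ 2 0 ltac:(lra); have := qZ 2^-1 0 ltac:(lra).
rewrite !scaler0; lra.
Qed.

Lemma sublinear0 q : sublinear q -> q 0 = 0.
Proof. by move=> sq; rewrite -(scale0r 0) sublinearZ// mul0r. Qed.

Lemma sublinear_ge_oppN q x : sublinear q -> - q (- x) <= q x.
Proof.
move=> sq; have := sq.1 x (- x); rewrite subrr sublinear0//; lra.
Qed.

Let dir q y x := [set q (x + t *: y) - t * q y | t in [set t | 0 <= t]].

Let dir_lb q y x : sublinear q -> lbound (dir q y x) (- q (- x)).
Proof.
move=> sq _ [t /= t0 <-].
have := sq.1 (x + t *: y) (- x).
by rewrite addrAC subrr add0r sublinearZ//; lra.
Qed.

(* Tilting q along y keeps it sublinear and below q, so it fixes a minimal q,
   which is therefore additive in the direction y. *)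
Let tilt q y x := inf (dir q y x).

Let tilt_le q y x t : sublinear q -> 0 <= t ->
  tilt q y x <= q (x + t *: y) - t * q y.
Proof.
move=> sq t0; apply: ge_inf; last by exists t.
by exists (- q (- x)); exact: dir_lb.
Qed.

Let le_tilt q y x m :
  (forall t, 0 <= t -> m <= q (x + t *: y) - t * q y) -> m <= tilt q y x.
Proof.
move=> H; apply: lb_le_inf.
  by exists (q (x + 0 *: y) - 0 * q y); exists 0 => //=.
by move=> _ [t /= t0 <-]; exact: H.
Qed.

Let tilt_sublinear q y : sublinear q -> sublinear (tilt q y).
Proof.
move=> sq; split=> [x z|a x a0].
  rewrite -lerBlDr; apply: le_tilt => t t0.
  rewrite lerBlDr -lerBlDl; apply: le_tilt => s s0.
  rewrite lerBlDr; apply: le_trans (tilt_le y (x + z) sq (addr_ge0 t0 s0)) _.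
  have := sq.1 (x + t *: y) (z + s *: y).
  by rewrite addrACA -scalerDl; lra.
rewrite -ler_pdivrMl//; apply: le_tilt => t t0.
rewrite ler_pdivrMl//.
apply: le_trans (tilt_le y (a *: x) sq (mulr_ge0 (ltW a0) t0)) _.
by rewrite -scalerA -scalerDr sublinearZ ?(ltW a0)//; lra.
Qed.

Let tilt_le_self q y x : sublinear q -> tilt q y x <= q x.
Proof.
move=> sq; have := tilt_le y x sq (lexx 0).
by rewrite scale0r mul0r subr0 addr0.
Qed.

Lemma linear_form_zmod (phi : V -> R^o) : linear phi ->
  [/\ forall x y, phi (x + y) = phi x + phi y,
      forall a x, phi (a *: x) = a * phi x,
      forall x, phi (- x) = - phi x,
      phi 0 = 0 & forall x y, phi (x - y) = phi x - phi y].
Proof.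
move=> lphi.
have D x y : phi (x + y) = phi x + phi y by rewrite -[x]scale1r lphi !scale1r.
have p0 : phi 0 = 0 by have := D 0 0; rewrite addr0; lra.
have Z a x : phi (a *: x) = a * phi x by rewrite -[a *: x]addr0 lphi p0 addr0.
have N x : phi (- x) = - phi x by rewrite -scaleN1r Z mulN1r.
by split=> // x y; rewrite D N.
Qed.

Lemma minimal_sublinear_linear q : sublinear q ->
  (forall r, sublinear r -> (forall x, r x <= q x) -> r = q) ->
  linear (q : V -> R^o).
Proof.
move=> sq qmin.
have tE y : tilt q y = q.
  by apply: qmin => [|x]; [exact: tilt_sublinear|exact: tilt_le_self].
have D x y : q (x + y) = q x + q y.
  apply/eqP; rewrite eq_le sq.1/=.
  by have := tilt_le y x sq ler01; rewrite tE scale1r mul1r; lra.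
have N x : q (- x) = - q x.
  by have := D x (- x); rewrite subrr sublinear0//; lra.
move=> a x y; rewrite D; congr (_ + _).
have [a0|a0] := leP 0 a; first by rewrite sublinearZ.
rewrite -[a *: x]opprK N -scaleNr sublinearZ ?oppr_ge0 ?ltW//.
by rewrite mulNr opprK.
Qed.

(** Zorn's lemma for the reversed pointwise order on the sublinear functionals below [q]: a nonempty
    chain is bounded by its pointwise infimum, finite by [- q (- x)], and a minimal element is
    linear. *)
Lemma exists_linear_le q : sublinear q ->
  exists phi : V -> R^o, linear phi /\ forall x, phi x <= q x.
Proof.
move=> sq.
pose T := {r : V -> R | sublinear r /\ forall x, r x <= q x}.
pose rel (r s : T) := `[< forall x, sval s x <= sval r x >].
have [|||A Atot|[r [sr rq]] rmax] := @Zorn T rel.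
- by move=> t; apply/asboolP.
- by move=> r s t /asboolP rs /asboolP st; apply/asboolP => x; exact: le_trans (rs x).
- move=> [r Hr] [s Hs] /asboolP/= rs /asboolP/= sr; apply: eq_exist.
  by apply/funext => x; apply/eqP; rewrite eq_le sr rs.
- have [[a0 Aa0]|A0] := pselect (A !=set0); last first.
    by exists (exist _ q (conj sq (fun=> lexx _))) => s As; exfalso; apply: A0; exists s.
  pose B x := [set sval s x | s in A].
  have Blb x : has_lbound (B x).
    exists (- q (- x)) => _ [[s [ss sl]] As <-]/=.
    by have := sublinear_ge_oppN x ss; have := sl (- x); lra.
  have Ble x s : A s -> inf (B x) <= sval s x.
    by move=> As; apply: ge_inf => //; exists s.
  have leB x m : (forall s, A s -> m <= sval s x) -> m <= inf (B x).
    move=> H; apply: lb_le_inf; first by exists (sval a0 x); exists a0.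
    by move=> _ [s As <-]; exact: H.
  (* Subadditivity uses that two members of the chain are comparable: the smaller one serves at both
     points. *)
  have sB : sublinear (fun x => inf (B x)).
    split=> [x y|a x a0'].
      rewrite -lerBlDr; apply: (leB) => s As; rewrite lerBlDr -lerBlDl.
      apply: (leB) => t At; rewrite lerBlDr.
      have [/asboolP st|/asboolP ts] := Atot _ _ As At.
        apply: le_trans (Ble _ _ At) _.
        by have := (svalP t).1.1 x y; have := st x; lra.
      apply: le_trans (Ble _ _ As) _.
      by have := (svalP s).1.1 x y; have := ts y; lra.
    rewrite -ler_pdivrMl//; apply: (leB) => s As; rewrite ler_pdivrMl//.
    by apply: le_trans (Ble _ _ As) _; exact: (svalP s).1.2.
  have Bq x : inf (B x) <= q x.
    by apply: le_trans (Ble _ _ Aa0) _; exact: (svalP a0).2.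
  pose sB' : T := exist _ (fun x => inf (B x)) (conj sB Bq).
  exists sB' => s As; apply/asboolP => x /=; exact: Ble.
- exists r; split=> //; apply: minimal_sublinear_linear => // s ss sler.
  have sq' x : s x <= q x by exact: le_trans (rq x).
  pose s' : T := exist _ s (conj ss sq').
  by have [] := rmax s' (asboolT sler).
Qed.

(** A linear form is taken below [tilt q v] rather than below [q]: at [- v] the tilt is at most
    [q 0 - q v = - q v], which forces [q v <= phi v]. *)
Theorem hahn_banach_support q v : sublinear q ->
  exists phi : V -> R^o, [/\ linear phi, forall x, phi x <= q x & phi v = q v].
Proof.
move=> sq; have [phi [lphi phil]] := exists_linear_le (tilt_sublinear v sq).
have phiq x : phi x <= q x by apply: le_trans (phil x) (tilt_le_self _ _ sq).
exists phi; split=> //; apply/eqP; rewrite eq_le phiq/=.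
have [_ _ N _ _] := linear_form_zmod lphi.
have := le_trans (phil (- v)) (tilt_le v (- v) sq ler01).
by rewrite scale1r mul1r addNr sublinear0// N; lra.
Qed.

End hahn_banach.

(** * Seminorms, and density by duality *)

Section seminorms.
Context {R : realType} {V : lmodType R}.
Implicit Types (p q : V -> R) (x y : V) (a r : R).

Definition seminorm p :=
  (forall x y, p (x + y) <= p x + p y) /\
  (forall a x, p (a *: x) = `|a| * p x).

Lemma seminorm0 p : seminorm p -> p 0 = 0.
Proof. by move=> [_ pZ]; rewrite -(scale0r 0) pZ normr0 mul0r. Qed.

Lemma seminormN p x : seminorm p -> p (- x) = p x.
Proof. by move=> [_ pZ]; rewrite -scaleN1r pZ normrN1 mul1r. Qed.

Lemma seminorm_ge0 p x : seminorm p -> 0 <= p x.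
Proof.
move=> sp; have := sp.1 x (- x).
by rewrite subrr seminorm0// seminormN//; lra.
Qed.

Lemma seminorm_distC p x y : seminorm p -> p (x - y) = p (y - x).
Proof. by move=> sp; rewrite -seminormN// opprB. Qed.

Lemma seminorm_triangle p x y z : seminorm p ->
  p (x - z) <= p (x - y) + p (y - z).
Proof. by move=> sp; have := sp.1 (x - y) (y - z); rewrite addrA subrK. Qed.

Lemma seminorm_sublinear p : seminorm p -> sublinear p.
Proof. by move=> [pD pZ]; split=> // a x a0; rewrite pZ gtr0_norm. Qed.

Lemma linear_le_seminorm p (phi : V -> R^o) x : seminorm p -> linear phi ->
  (forall x, phi x <= p x) -> `|phi x| <= p x.
Proof.
move=> sp lphi phip; rewrite ler_norml phip andbT.
have [_ _ N _ _] := linear_form_zmod lphi.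
by have := phip (- x); rewrite N seminormN//; lra.
Qed.

(** Rational coefficients and lists keep these combinations countable when [I] is, so that they can
    be enumerated by codes. *)
Definition rat_comb {I : Type} (v : I -> V) (l : seq (rat * I)) : V :=
  \sum_(t <- l) ratr t.1 *: v t.2.

Lemma rat_comb_cat I (v : I -> V) (l k : seq (rat * I)) :
  rat_comb v (l ++ k) = rat_comb v l + rat_comb v k.
Proof. by rewrite /rat_comb big_cat. Qed.

Lemma rat_combZ I (v : I -> V) (b : rat) (l : seq (rat * I)) :
  rat_comb v [seq (b * t.1, t.2) | t <- l] = ratr b *: rat_comb v l.
Proof.
rewrite /rat_comb big_map scaler_sumr; apply: eq_bigr => t _ /=.
by rewrite rmorphM scalerA.
Qed.

Lemma rat_approx a r : 0 < r -> exists b : rat, `|a - ratr b| < r.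
Proof.
move=> r0; have [b] := rat_in_itvoo (ltac:(lra) : a - r < a + r).
rewrite in_itv/= => /andP[ab ba]; exists b.
by rewrite ltr_norml; apply/andP; split; lra.
Qed.

(** The [p]-distance [q] to the closure [N] of the rational combinations is sublinear. A linear form
    below [q] and equal to it at [x] vanishes on [N], hence at [x], so the distance of [x] is 0. *)
Lemma rat_comb_dense I (v : I -> V) p x : seminorm p ->
  (forall phi : V -> R^o, linear phi -> (forall x, phi x <= p x) ->
    (forall i, phi (v i) = 0) -> phi x = 0) ->
  forall r, 0 < r -> exists l, p (x - rat_comb v l) < r.
Proof.
move=> sp hphi.
pose N y := forall r, 0 < r -> exists l, p (y - rat_comb v l) < r.
have ND y z : N y -> N z -> N (y + z).
  move=> Ny Nz r r0; have r2 : 0 < r / 2 by lra.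
  have [l ly] := Ny _ r2; have [k kz] := Nz _ r2.
  exists (l ++ k); rewrite rat_comb_cat opprD addrACA.
  by have := sp.1 (y - rat_comb v l) (z - rat_comb v k); lra.
(* [N] is stable under real scalars: vector and scalar are approximated separately, each at cost
   [r / 2]. *)
have NZ (a : R) y : N y -> N (a *: y).
  move=> Ny r r0.
  have a1 : 0 < `|a| + 1 by rewrite ltr_wpDl.
  have [l ly] := Ny (r / 2 / (`|a| + 1)) ltac:(by rewrite !divr_gt0).
  have p1 : 0 < p (rat_comb v l) + 1 by rewrite ltr_wpDl ?seminorm_ge0.
  have [b ab] := rat_approx a (ltac:(by rewrite !divr_gt0) :
    0 < r / 2 / (p (rat_comb v l) + 1)).
  exists [seq (b * t.1, t.2) | t <- l]; rewrite rat_combZ.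
  have -> : a *: y - ratr b *: rat_comb v l =
      a *: (y - rat_comb v l) + (a - ratr b) *: rat_comb v l.
    by rewrite scalerBr scalerBl addrA subrK.
  apply: le_lt_trans (sp.1 _ _) _; rewrite !sp.2.
  have h1 : `|a| * p (y - rat_comb v l) <= r / 2.
    apply: le_trans (_ : (`|a| + 1) * p (y - rat_comb v l) <= _).
      by rewrite ler_wpM2r ?seminorm_ge0// lerDl.
    by rewrite -ler_pdivlMl// mulrC ltW.
  have h2 : `|a - ratr b| * p (rat_comb v l) < r / 2.
    apply: le_lt_trans (_ : `|a - ratr b| * (p (rat_comb v l) + 1) < _).
      by rewrite ler_wpM2l// lerDl.
    by rewrite -ltr_pdivlMr.
  by lra.
have N0 : N 0.
  by move=> r r0; exists [::]; rewrite /rat_comb big_nil subr0 seminorm0.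
have Nv i : N (v i).
  move=> r r0; exists [:: (1, i)].
  by rewrite /rat_comb big_seq1 rmorph1 scale1r subrr seminorm0.
pose D y := [set p (y - z) | z in N].
pose q y := inf (D y).
have qle y z : N z -> q y <= p (y - z).
  move=> Nz; apply: ge_inf; last by exists z.
  by exists 0 => _ [w _ <-]; exact: seminorm_ge0.
have leq y (m : R) : (forall z, N z -> m <= p (y - z)) -> m <= q y.
  move=> H; apply: lb_le_inf; first by exists (p (y - 0)); exists 0.
  by move=> _ [w Nw <-]; exact: H.
have sq : sublinear q.
  split=> [y z|a y a0].
    rewrite -lerBlDr; apply: (leq) => u Nu; rewrite lerBlDr -lerBlDl.
    apply: (leq) => w Nw; rewrite lerBlDr.
    apply: le_trans (qle _ _ (ND _ _ Nu Nw)) _.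
    by rewrite opprD addrACA addrC; exact: sp.1.
  rewrite -ler_pdivrMl//; apply: (leq) => z Nz; rewrite ler_pdivrMl//.
  apply: le_trans (qle _ _ (NZ a _ Nz)) _.
  by rewrite -scalerBr sp.2 gtr0_norm.
have [phi [lphi phiq phix]] := hahn_banach_support x sq.
have [_ _ phiN phi0 _] := linear_form_zmod lphi.
have phiN0 z : N z -> phi z = 0.
  have H w : N w -> phi w <= 0.
    move=> Nw; apply: le_trans (phiq w) _; apply: le_trans (qle _ _ Nw) _.
    by rewrite subrr seminorm0.
  move=> Nz; have := H _ Nz; have := H _ (NZ (-1) _ Nz).
  by rewrite scaleN1r phiN; lra.
have qx : q x = 0.
  rewrite -phix; apply: hphi => // [y|i]; last exact: phiN0.
  by apply: le_trans (phiq y) _; have := qle y 0 N0; rewrite subr0.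
move=> r r0.
have r2 : q x < r / 2 by lra.
have [_ [z Nz <-] pz] := inf_lt (ltac:(by exists (p (x - 0)); exists 0) : D x !=set0) r2.
have [l lz] := Nz (r / 2) ltac:(lra).
exists l; have := seminorm_triangle x z (rat_comb v l) sp; lra.
Qed.

Lemma seminorm_norming p x : seminorm p ->
  exists phi : V -> R^o, [/\ linear phi, forall y, `|phi y| <= p y & phi x = p x].
Proof.
move=> sp.
have [phi [lphi phip phix]] := hahn_banach_support x (seminorm_sublinear sp).
by exists phi; split=> // y; exact: linear_le_seminorm.
Qed.

End seminorms.

(** * Convex functions on a seminormed space *)

Section convex_seminormed.
Context {R : realType} {V : lmodType R}.
Variable p : V -> R.
Hypothesis sp : seminorm p.
Implicit Types (x y z u v w e : V) (r s t a c : R) (f : V -> R).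

Definition convex_on (U : set V) f := forall x y t, U x -> U y ->
  0 <= t -> t <= 1 -> f (t *: x + (1 - t) *: y) <= t * f x + (1 - t) * f y.

Definition sball x r : set V := [set y | p (y - x) < r].

Definition lipschitz_on (U : set V) f L :=
  forall x y, U x -> U y -> f x - f y <= L * p (x - y).

Definition second_diff f x v := f (x + v) + f (x - v) - 2 * f x.

Lemma sball_convex x r y z t : sball x r y -> sball x r z ->
  0 <= t -> t <= 1 -> sball x r (t *: y + (1 - t) *: z).
Proof.
rewrite /sball/= => yr zr t0 t1.
have -> : t *: y + (1 - t) *: z - x = t *: (y - x) + (1 - t) *: (z - x).
  rewrite !scalerBr addrACA -opprD -scalerDl addrCA subrr addr0 scale1r.
  by [].
apply: le_lt_trans (sp.1 _ _) _.
rewrite !sp.2 !ger0_norm ?subr_ge0//.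
have [->|tN0] := eqVneq t 0; first by rewrite mul0r subr0 mul1r add0r.
have tp : 0 < t by rewrite lt_neqAle eq_sym tN0.
have h1 : t * p (y - x) < t * r by rewrite ltr_pM2l.
have h2 : (1 - t) * p (z - x) <= (1 - t) * r.
  by rewrite ler_wpM2l ?subr_ge0// ltW.
lra.
Qed.

(** Reflection through [x] bounds [f] below by [m]. Prolonging the segment from [y] to [z] by at
    most [r / 2] stays in the ball, and convexity on the longer segment bounds the slope by
    [2 * (M - m) / r]. *)
Lemma convex_bounded_lipschitz f x r M : 0 < r ->
  convex_on (sball x r) f -> (forall y, sball x r y -> f y <= M) ->
  exists2 L, 0 <= L & lipschitz_on (sball x (r / 2)) f L.
Proof.
rewrite /sball => r0 cf fM.
pose m := 2 * f x - M.
have fm y : p (y - x) < r -> m <= f y.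
  move=> yr.
  have yr' : p (x + (x - y) - x) < r.
    by rewrite addrAC subrr add0r seminorm_distC.
  have := cf y (x + (x - y)) (2^-1) yr yr' ltac:(lra) ltac:(lra).
  have -> : 2^-1 *: y + (1 - 2^-1) *: (x + (x - y)) = x.
    have -> : 1 - 2^-1 = 2^-1 :> R by lra.
    rewrite -scalerDr [x + _]addrA [y + _]addrC subrK -mulr2n -[x *+ 2]scaler_nat scalerA.
    by rewrite mulVf ?scale1r.
  by have := fM _ yr'; rewrite /m; lra.
have mM : m <= M by rewrite /m; have := fM x ltac:(by rewrite /= subrr seminorm0); lra.
exists (2 * (M - m) / r).
  by rewrite divr_ge0 ?(ltW r0)// mulr_ge0// subr_ge0.
move=> z y /= zr yr; apply/ler_addgt0Pr => eps eps0.
have p0 := seminorm_ge0 (z - y) sp.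
pose K := 2 * (M - m) / r.
have K0 : 0 <= K by rewrite divr_ge0 ?(ltW r0)// mulr_ge0// subr_ge0.
(* [p (z - y)] may vanish, so the prolongation is normalised by a slightly larger [s]; the excess
   costs at most [eps]. *)
pose s := p (z - y) + eps / (K + 1).
have K1 : 0 < K + 1 by rewrite ltr_wpDl.
have eK : 0 < eps / (K + 1) by rewrite divr_gt0.
have s0 : 0 < s by rewrite /s; lra.
have sr : 0 < s + r / 2 by lra.
pose w := z + (r / 2 / s) *: (z - y).
have wr : p (w - x) < r.
  rewrite /w addrAC; apply: le_lt_trans (sp.1 _ _) _.
  rewrite sp.2 ger0_norm; last by rewrite !divr_ge0 ?(ltW r0)// (ltW s0).
  suff : r / 2 / s * p (z - y) <= r / 2 by lra.
  rewrite mulrAC ler_pdivrMr// ler_wpM2l//; first by lra.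
  by rewrite /s; lra.
pose l := s / (s + r / 2).
have l0 : 0 < l by rewrite divr_gt0.
have l1 : l <= 1 by rewrite ler_pdivrMr//; lra.
have yr' : p (y - x) < r by lra.
have := cf w y l wr yr' (ltW l0) l1.
have -> : l *: w + (1 - l) *: y = z.
  rewrite /w scalerDr scalerA scalerBr addrA -scalerDl -addrA -scaleNr -scalerDl.
  have -> : l + l * (r / 2 / s) = 1.
    by rewrite /l; field; rewrite !lt0r_neq0//; lra.
  have -> : - (l * (r / 2 / s)) + (1 - l) = 0.
    by rewrite /l; field; rewrite !lt0r_neq0//; lra.
  by rewrite scale1r scale0r addr0.
move=> fz.
have fzy : f z - f y <= l * (M - m).
  have h : l * (f w - f y) <= l * (M - m).
    rewrite ler_wpM2l ?(ltW l0)// lerB//; first exact: fM.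
    exact: fm.
  lra.
have lK : l * (M - m) <= K * s.
  rewrite /l /K mulrAC ler_pdivrMr//.
  have -> : 2 * (M - m) / r * s * (s + r / 2) =
      s * (M - m) + 2 * (M - m) / r * s * s.
    by field; rewrite lt0r_neq0.
  by rewrite lerDl !mulr_ge0 ?(ltW s0)// ?invr_ge0 ?(ltW r0)// subr_ge0.
have Ke : K * (eps / (K + 1)) <= eps.
  by rewrite mulrA ler_pdivrMr// mulrC ler_wpM2l ?(ltW eps0)// lerDl.
have : K * s = K * p (z - y) + K * (eps / (K + 1)) by rewrite /s mulrDr.
by rewrite -/K; lra.
Qed.

(** The infimum [q v] of the difference quotients at [y] is the one-sided directional derivative. It
    is sublinear and at most [L * p v], and any linear form below it is a subgradient. *)
Lemma subgradient_exists f x0 r L y : 0 <= L ->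
  convex_on (sball x0 r) f -> lipschitz_on (sball x0 r) f L -> sball x0 r y ->
  exists psi : V -> R^o, [/\ linear psi, forall v, psi v <= L * p v &
    forall v, sball x0 r (y + v) -> f y + psi v <= f (y + v)].
Proof.
move=> L0 cf lf yr.
pose Q v := [set (f (y + t *: v) - f y) / t |
  t in [set t | 0 < t /\ sball x0 r (y + t *: v)]].
pose q v := inf (Q v).
have Qlb v : lbound (Q v) (- (L * p v)).
  move=> _ [t /= [t0 tr] <-]; rewrite ler_pdivlMr//.
  have := lf _ _ yr tr.
  rewrite opprD addrA subrr add0r (seminormN _ sp) sp.2 gtr0_norm//; lra.
have qle v t : 0 < t -> sball x0 r (y + t *: v) ->
    q v <= (f (y + t *: v) - f y) / t.
  move=> t0 tr; apply: ge_inf; last by exists t.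
  by exists (- (L * p v)); exact: Qlb.
have Qne v : exists2 t, 0 < t & sball x0 r (y + t *: v).
  have p1 : 0 < p v + 1 by rewrite ltr_wpDl ?seminorm_ge0.
  move: yr; rewrite /sball/= => yr.
  exists ((r - p (y - x0)) / (p v + 1)); first by rewrite divr_gt0// subr_gt0.
  rewrite addrAC; apply: le_lt_trans (sp.1 _ _) _.
  rewrite sp.2 gtr0_norm; last by rewrite divr_gt0// subr_gt0.
  suff : (r - p (y - x0)) / (p v + 1) * p v < r - p (y - x0) by lra.
  rewrite mulrAC ltr_pdivrMr// ltr_pM2l ?subr_gt0//; lra.
have leq v m : (forall t, 0 < t -> sball x0 r (y + t *: v) ->
    m <= (f (y + t *: v) - f y) / t) -> m <= q v.
  move=> H; apply: lb_le_inf; last by move=> _ [t /= [t0 tr] <-]; exact: H.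
  have [t t0 tr] := Qne v.
  by exists ((f (y + t *: v) - f y) / t); exists t.
have sq : sublinear q.
  split=> [u v|a v a0].
    rewrite -lerBlDr; apply: (leq) => t t0 tr; rewrite lerBlDr -lerBlDl.
    apply: (leq) => s s0 sr; rewrite lerBlDr.
    have st : 0 < s + t by lra.
    (* This weight equalises the coefficients of [u] and [v], so the combination is a step of length
       [s * t / (s + t)] along [u + v]. *)
    pose l := s / (s + t).
    have l0 : 0 <= l by rewrite divr_ge0 ?ltW.
    have l1 : l <= 1 by rewrite ler_pdivrMr//; lra.
    have E : l *: (y + t *: u) + (1 - l) *: (y + s *: v) =
        y + (s * t / (s + t)) *: (u + v).
      have ly : l *: y + (1 - l) *: y = y by rewrite -scalerDl addrC subrK scale1r.
      rewrite !scalerDr addrACA ly !scalerA.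
      congr (_ + (_ *: _ + _ *: _)); rewrite /l; first by field; rewrite lt0r_neq0.
      by field; rewrite lt0r_neq0.
    have := cf _ _ _ tr sr l0 l1; have := sball_convex tr sr l0 l1.
    rewrite E => ur fu.
    have stp : 0 < s * t / (s + t) by rewrite !divr_gt0// mulr_gt0.
    apply: le_trans (qle _ _ stp ur) _.
    rewrite ler_pdivrMr//.
    have -> : ((f (y + s *: v) - f y) / s + (f (y + t *: u) - f y) / t) *
        (s * t / (s + t)) =
        l * f (y + t *: u) + (1 - l) * f (y + s *: v) - f y.
      by rewrite /l; field; rewrite !lt0r_neq0.
    by rewrite lerB.
  rewrite -ler_pdivrMl//; apply: (leq) => t t0 tr; rewrite ler_pdivrMl//.
  have ta : (t / a) *: (a *: v) = t *: v by rewrite scalerA divfK ?lt0r_neq0.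
  have := qle (a *: v) (t / a); rewrite ta divr_gt0// => /(_ isT tr).
  by move=> /le_trans; apply; rewrite invf_div mulrCA mulrA.
have [psi [lpsi psiq]] := exists_linear_le sq.
exists psi; split=> // [v|v vr].
  have [t t0 tr] := Qne v.
  apply: le_trans (psiq v) _; apply: le_trans (qle _ _ t0 tr) _.
  rewrite ler_pdivrMr//; apply: le_trans (lf _ _ tr yr) _.
  by rewrite addrAC subrr add0r sp.2 gtr0_norm//; lra.
have := qle v 1 ltr01; rewrite scale1r divr1 => /(_ vr).
have := psiq v; lra.
Qed.

End convex_seminormed.

(** * Nested balls and small second differences *)

Section complete_seminormed.
Context {R : realType} {V : lmodType R}.
Variable p : V -> R.
Hypothesis sp : seminorm p.
Implicit Types (x y z u v w e : V) (r c d L eps K : R) (f : V -> R).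

Definition seminorm_complete := forall u : nat -> V,
  (forall eps, 0 < eps -> exists N, forall i j, (N <= i)%N -> (N <= j)%N ->
     p (u i - u j) < eps) ->
  exists x, forall eps, 0 < eps -> exists N, forall i, (N <= i)%N ->
    p (u i - x) < eps.

(* For the norm of a Banach space: separable subspaces have a separable dual. *)
Definition countably_approximable := forall (I : countType) (e : I -> V),
  (forall i, p (e i) <= 1) -> exists ck : nat -> I -> R,
  forall (psi : V -> R^o) K, linear psi -> (forall v, psi v <= K * p v) ->
  forall eps, 0 < eps -> exists k, forall i, `|psi (e i) - ck k i| <= eps.

Hypothesis cp : seminorm_complete.

(** A Baire-type iteration: each step picks a ball inside the previous one with at most half its
    radius, and completeness gives a common point. Balls are indexed by an abstract [T], which can
    record more than the centre, such as a branch of a tree; radius 0 is allowed. *)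
Lemma nested_balls (T : Type) (ctr : T -> V) (rad : T -> R) (Inv : T -> Prop)
    (Good : nat -> T -> Prop) (t0 : T) :
  (forall t, Inv t -> 0 <= rad t) -> Inv t0 ->
  (forall k t, Inv t -> exists t', [/\ Inv t',
     p (ctr t' - ctr t) + rad t' <= rad t, rad t' <= rad t / 2 & Good k t']) ->
  exists y, p (y - ctr t0) <= rad t0 /\
    forall k, exists t, [/\ Inv t, Good k t, p (y - ctr t) <= rad t &
      rad t <= rad t0 / 2 ^+ k.+1].
Proof.
move=> rad0 It0 step.
have /choice[g gP] : forall kt : nat * {t | Inv t}, exists t' : {t | Inv t},
    [/\ p (ctr (sval t') - ctr (sval kt.2)) + rad (sval t') <= rad (sval kt.2),
       rad (sval t') <= rad (sval kt.2) / 2 & Good kt.1 (sval t')].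
  move=> [k [t It]]; have [t' [It' ? ? ?]] := step k t It.
  by exists (exist _ t' It').
pose fix s n : {t | Inv t} :=
  if n is m.+1 then g (m, s m) else exist _ t0 It0.
pose c n := ctr (sval (s n)); pose r n := rad (sval (s n)).
have rp n : 0 <= r n by apply: rad0; exact: svalP.
have cS n : p (c n.+1 - c n) + r n.+1 <= r n by have [] := gP (n, s n).
have rS n : r n.+1 <= r n / 2 by have [] := gP (n, s n).
have nest n m : p (c (n + m)%N - c n) + r (n + m)%N <= r n.
  elim: m => [|m IH]; first by rewrite addn0 subrr seminorm0// add0r.
  rewrite addnS; have := cS (n + m)%N.
  by have := seminorm_triangle (c (n + m).+1) (c (n + m)%N) (c n) sp; lra.
have rle n : r n <= r 0%N / 2 ^+ n.
  elim: n => [|n IH]; first by rewrite expr0 divr1.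
  by rewrite exprS invfM mulrCA mulrC; apply: le_trans (rS n) _; lra.
have rsmall (e : R) : 0 < e -> exists N, r N < e.
  move=> e0; pose N := (Num.truncn (r 0%N / e)).+1.
  exists N; apply: le_lt_trans (rle N) _.
  rewrite ltr_pdivrMr ?exprn_gt0// -ltr_pdivrMl// mulrC.
  apply: lt_trans (truncnS_gt _) _.
  by rewrite -natrX ltr_nat ltn_expl.
have [|y yP] := cp (u := c).
  move=> e e0; have [N rN] := rsmall (e / 2) ltac:(lra).
  exists N => i j Ni Nj.
  have := nest N (i - N)%N; have := nest N (j - N)%N; rewrite !subnKC//.
  have := seminorm_triangle (c i) (c N) (c j) sp.
  have := rp i; have := rp j; rewrite (seminorm_distC (c N))//; lra.
have yc n : p (y - c n) <= r n.
  apply/ler_addgt0Pr => e e0; have [N yN] := yP e e0.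
  have := yN (n + N)%N (leq_addl _ _); have := nest n N; have := rp (n + N)%N.
  have := seminorm_triangle y (c (n + N)%N) (c n) sp.
  rewrite (seminorm_distC y (c (n + N)%N))//; lra.
exists y; split; first exact: (yc 0%N).
move=> k; exists (sval (s k.+1)); split; first exact: svalP.
  by have [] := gP (k, s k).
- exact: yc.
- exact: rle.
Qed.

Hypothesis ap : countably_approximable.

(* If the second differences are large at every point, following them from the
   centre gives a countable tree of points.  At each node, some slope in the
   chosen direction is far from the k-th functional of a countable dense family,
   and so are all the subgradients around the corresponding child: a subgradient
   at the limit of a branch is far from the whole dense family. *)
Lemma small_second_diff f x0 r L c : 0 < r -> 0 <= L ->
  convex_on (sball p x0 r) f -> lipschitz_on p (sball p x0 r) f L -> 0 < c ->
  exists x d, [/\ 0 < d, p (x - x0) + d < r &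
    forall e, p e <= 1 -> second_diff f x (d *: e) <= c * d].
Proof.
move=> r0 L0 cf lf c0; apply/not_existsP => H.
(* [sel] is made total by the value 0 where the pair does not fit into the ball, so that all
   directions stay in the unit ball. *)
have {H}/choice[sel selP] : forall xd : V * R, exists e, p e <= 1 /\
    (0 < xd.2 -> p (xd.1 - x0) + xd.2 < r ->
     c * xd.2 < second_diff f xd.1 (xd.2 *: e)).
  move=> [x d]/=.
  have [[d0 xd]|H0] := pselect (0 < d /\ p (x - x0) + d < r); last first.
    by exists 0; rewrite seminorm0//; split=> // d0 xd; exfalso; exact: H0.
  apply: contrapT => H1; apply: (H x); exists d; split=> // e e1.
  by rewrite leNgt; apply/negP => ce; apply: H1; exists e.
pose dl (j : nat) : R := j.+1%:R^-1.
have dl0 j : 0 < dl j by rewrite invr_gt0.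
(* A node is a list of moves, latest first: [(j, b)] moves by [dl j] along the selected direction,
   forwards or backwards according to [b]. Lists make the family of directions [e] countable. *)
pose fix node (s : seq (nat * bool)) : V :=
  if s is (j, b) :: s' then
    node s' + (if b then dl j else - dl j) *: sel (node s', dl j)
  else x0.
pose e (i : seq (nat * bool) * nat) := sel (node i.1, dl i.2).
have e1 i : p (e i) <= 1 by have [] := selP (node i.1, dl i.2).
have [ck ckP] := ap e1.
pose Inv (t : seq (nat * bool) * R) :=
  0 < t.2 /\ p (node t.1 - x0) + t.2 <= r / 2.
pose Good k (t : seq (nat * bool) * R) := exists i, forall y,
  p (y - node t.1) <= t.2 -> forall psi : V -> R^o, linear psi ->
  (forall v, sball p x0 r (y + v) -> f y + psi v <= f (y + v)) ->
  c / 4 <= `|psi (e i) - ck k i|.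
have [|||y [yx0 yP]] := @nested_balls _ (fun t => node t.1) snd Inv Good ([::], r / 2).
- by move=> t [/ltW].
- by rewrite /Inv/= subrr seminorm0//; split; lra.
- move=> k [s rho] [/= rho0 srho].
  have [j jrho] : exists j, dl j <= rho / 2.
    exists (Num.truncn (2 / rho)); rewrite invf_ple ?posrE//; last by lra.
    by rewrite invf_div ltW// truncnS_gt.
  set x := node s in srho; set d := dl j in jrho; have d0 : 0 < d := dl0 j.
  have [/= ej1 /(_ d0)] := selP (x, d); set ej := sel (x, d) in ej1 * => ejc.
  have {ejc} : c * d < second_diff f x (d *: ej) by apply: ejc; lra.
  rewrite /second_diff => ejc.
  have pd : p (d *: ej) <= d by rewrite sp.2 gtr0_norm// ger_pMr.
  (* Moving by [rho'] changes [f] by at most [c * d / 8]; [key] makes two such moves, hence its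
     error [c * d / 4]. *)
  pose rho' := Num.min (rho / 2) (c * d / (8 * (L + 1))).
  have rho'0 : 0 < rho' by rewrite lt_min !divr_gt0 ?mulr_gt0//; lra.
  have rho'1 : rho' <= rho / 2 by rewrite ge_min lexx.
  have rho'2 : L * rho' <= c * d / 8.
    have : rho' <= c * d / (8 * (L + 1)) by rewrite ge_min lexx orbT.
    rewrite ler_pdivlMr; last by rewrite mulr_gt0//; lra.
    have := mulr_ge0 L0 (ltW rho'0); lra.
  (* The subgradient inequality is used at [y] towards [y - v], which is near [x]. It bounds
     [psi ej] below by the forward quotient at a forward child, and above by the backward quotient
     at a backward child. *)
  have key b y : p (y - (x + (if b then d else - d) *: ej)) <= rho' ->
      forall psi : V -> R^o, linear psi ->
      (forall v, sball p x0 r (y + v) -> f y + psi v <= f (y + v)) ->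
      (if b then f (x + d *: ej) - f x - c * d / 4 <= d * psi ej
       else d * psi ej <= f x - f (x - d *: ej) + c * d / 4).
    move=> yb psi lpsi ypsi.
    have [_ pZ pN _ _] := linear_form_zmod lpsi.
    pose v := (if b then d else - d) *: ej.
    have pv : p v <= d.
      by rewrite /v; case: (b) => //; rewrite scaleNr seminormN.
    have Ux : sball p x0 r x by rewrite /sball/=; lra.
    have Uxv : sball p x0 r (x + v).
      rewrite /sball/=; have := sp.1 (x - x0) v; rewrite addrAC; lra.
    have yv : p (y - (x + v)) <= rho' by [].
    have Uy : sball p x0 r y.
      rewrite /sball/=; have := seminorm_triangle y (x + v) x0 sp.
      have := sp.1 (x - x0) v; rewrite [x - x0 + v]addrAC; lra.
    have yv' : p (y - v - x) <= rho' by rewrite -addrA -opprD addrC [v + x]addrC addrC.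
    have Uyv : sball p x0 r (y - v).
      by rewrite /sball/=; have := seminorm_triangle (y - v) x x0 sp; lra.
    have := ypsi (- v) Uyv; have := lf _ _ Uxv Uy; have := lf _ _ Uyv Ux.
    have : L * p (y - v - x) <= L * rho' by rewrite ler_wpM2l.
    have : L * p (x + v - y) <= L * rho' by rewrite ler_wpM2l// seminorm_distC.
    rewrite /v pN pZ; case: (b); first by lra.
    by rewrite scaleNr opprK; lra.
  have stepP b : [/\ 0 < rho', p (node ((j, b) :: s) - x0) + rho' <= r / 2,
      p (node ((j, b) :: s) - x) + rho' <= rho & rho' <= rho / 2].
    have pb : p (node ((j, b) :: s) - x) <= d.
      rewrite /= -/x -/d -/ej addrAC subrr add0r.
      by case: (b) => //; rewrite scaleNr seminormN.
    split=> //; last by lra.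
    by have := seminorm_triangle (node ((j, b) :: s)) x x0 sp; lra.
  (* The forward and backward quotients at [x] differ by more than [c], so one lies at least [c / 2]
     away from [ck k (s, j)] on its own side; the branch goes to that child. *)
  have [hi|lo] := leP (d * (ck k (s, j) + c / 2)) (f (x + d *: ej) - f x).
    exists ((j, true) :: s, rho'); have [h1 h2 h3 h4] := stepP true.
    split=> //; exists (s, j) => y yb psi lpsi ypsi.
    have := key true y yb psi lpsi ypsi; rewrite /e/= -/x -/d -/ej => h.
    have : d * (c / 4) <= d * (psi ej - ck k (s, j)) by lra.
    by rewrite ler_pM2l// => /le_trans; apply; exact: ler_norm.
  exists ((j, false) :: s, rho'); have [h1 h2 h3 h4] := stepP false.
  split=> //; exists (s, j) => y yb psi lpsi ypsi.
  have := key false y yb psi lpsi ypsi; rewrite /e/= -/x -/d -/ej => h.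
  have : d * (c / 4) <= d * - (psi ej - ck k (s, j)) by lra.
  by rewrite ler_pM2l// => /le_trans; apply; rewrite -normrN ler_norm.
have Uy : sball p x0 r y by rewrite /sball/=; move: yx0 => /=; lra.
have [psi [lpsi psiL psiy]] := subgradient_exists sp L0 cf lf Uy.
have [k kP] := ckP psi L lpsi psiL (c / 8) ltac:(lra).
have [t [_ [i iP] yt _]] := yP k.
have := iP y yt psi lpsi psiy; have := kP i; lra.
Qed.

(** A point is found for [c / 2]; the Lipschitz bound spreads its estimate to a ball, the four
    increments of [f] costing [c * d / 8] each. *)
Lemma small_second_diff_near f x0 r L c : 0 < r -> 0 <= L ->
  convex_on (sball p x0 r) f -> lipschitz_on p (sball p x0 r) f L -> 0 < c ->
  exists x rho d, [/\ 0 < rho, 0 < d & forall x', p (x' - x) <= rho ->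
    p (x' - x0) + d < r /\
    forall e, p e <= 1 -> second_diff f x' (d *: e) <= c * d].
Proof.
move=> r0 L0 cf lf c0.
have [x [d [d0 xd xP]]] :=
  small_second_diff r0 L0 cf lf (ltac:(lra) : 0 < c / 2).
pose rho := Num.min ((r - p (x - x0) - d) / 2) (c * d / (8 * (L + 1))).
have rho0 : 0 < rho by rewrite lt_min !divr_gt0 ?mulr_gt0//; lra.
have rho1 : rho <= (r - p (x - x0) - d) / 2 by rewrite ge_min lexx.
have rho2 : L * rho <= c * d / 8.
  have : rho <= c * d / (8 * (L + 1)) by rewrite ge_min lexx orbT.
  rewrite ler_pdivlMr; last by rewrite mulr_gt0//; lra.
  have := mulr_ge0 L0 (ltW rho0); lra.
exists x, rho, d; split=> // x' x'x.
have x'd : p (x' - x0) + d < r by have := seminorm_triangle x' x x0 sp; lra.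
split=> // e e1; have := xP e e1; rewrite /second_diff.
have pd : p (d *: e) <= d by rewrite sp.2 gtr0_norm// ger_pMr.
have U z v : p (z - x0) + d < r -> p v <= d -> sball p x0 r (z + v).
  by move=> zd vd; rewrite /sball/= addrAC; have := sp.1 (z - x0) v; lra.
have shift v : p v <= d -> f (x' + v) - f (x + v) <= c * d / 8.
  move=> vd; apply: le_trans (lf _ _ (U x' v x'd vd) (U x v xd vd)) _.
  by rewrite opprD addrACA subrr addr0; apply: le_trans rho2; rewrite ler_wpM2l.
have pNd : p (- (d *: e)) <= d by rewrite seminormN.
have := shift _ pd; have := shift _ pNd.
have U0 z : p (z - x0) + d < r -> sball p x0 r z by rewrite /sball/=; lra.
have := lf _ _ (U0 _ xd) (U0 _ x'd).
have : L * p (x - x') <= L * rho by rewrite ler_wpM2l// seminorm_distC.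
by lra.
Qed.

Lemma smooth_point_exists f x0 r L : 0 < r -> 0 <= L ->
  convex_on (sball p x0 r) f -> lipschitz_on p (sball p x0 r) f L ->
  exists2 y, sball p x0 r y & forall k, exists rho d, [/\ 0 < rho, 0 < d &
    forall x', p (x' - y) <= rho -> p (x' - x0) + d < r /\
      forall e, p e <= 1 -> second_diff f x' (d *: e) <= k.+1%:R^-1 * d].
Proof.
move=> r0 L0 cf lf.
pose Inv (t : V * R) := 0 < t.2 /\ p (t.1 - x0) + t.2 < r.
(* The estimate is required on twice the ball: the limit point may lie on the boundary, and a
   neighbourhood of it must still be covered. *)
pose Good k (t : V * R) := exists2 d, 0 < d &
  forall x', p (x' - t.1) <= 2 * t.2 -> p (x' - x0) + d < r /\
    forall e, p e <= 1 -> second_diff f x' (d *: e) <= k.+1%:R^-1 * d.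
have [|||y [yx0 yP]] := @nested_balls _ fst snd Inv Good (x0, r / 2).
- by move=> t [/ltW].
- by rewrite /Inv/= subrr seminorm0//; split; lra.
- move=> k [x rho] [/= rho0 xrho].
  have sub : sball p x (rho / 2) `<=` sball p x0 r.
    move=> z; rewrite /sball/=; have := seminorm_triangle z x x0 sp; lra.
  have [x1 [rho1 [d [rho10 d0 x1P]]]] := small_second_diff_near
    (ltac:(lra) : 0 < rho / 2) L0
    (fun y z t yU zU => cf y z t (sub _ yU) (sub _ zU))
    (fun y z yU zU => lf y z (sub _ yU) (sub _ zU))
    (ltac:(by rewrite invr_gt0) : 0 < k.+1%:R^-1).
  have x1x : p (x1 - x) + d < rho / 2.
    by have [] := x1P x1; rewrite // subrr seminorm0// ltW.
  pose rho' := Num.min (rho1 / 2) (rho / 4).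
  have h1 : rho' <= rho1 / 2 by rewrite ge_min lexx.
  have h2 : rho' <= rho / 4 by rewrite ge_min lexx orbT.
  have h3 : 0 < rho' by rewrite lt_min; apply/andP; split; lra.
  exists (x1, rho'); split=> //=; first 2 last.
  - lra.
  - exists d => //= x' x'x1; have [|h4 h5] := x1P x'; first by lra.
    by split=> //; have := seminorm_triangle x' x x0 sp; lra.
  - by split=> //=; have := seminorm_triangle x1 x x0 sp; lra.
  - lra.
exists y; first by rewrite /sball/=; move: yx0 => /=; lra.
move=> k; have [[x rho] [[/= rho0 _] [d d0 dP] yx _]] := yP k.
exists rho, d; split=> // x' x'y; apply: dP => /=.
have := seminorm_triangle x' y x sp; move: yx => /=; lra.
Qed.

End complete_seminormed.

(** * Open mapping theorem *)

Section open_mapping.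
Context {R : realType}.
Implicit Types X Y : completeNormedModType R.

Lemma norm_seminorm (X : normedModType R) : seminorm (fun x : X => `|x|).
Proof. by split=> [x y|a x]; [exact: ler_normD|exact: normrZ]. Qed.

Lemma norm_complete X : seminorm_complete (fun x : X => `|x|).
Proof.
move=> u cu.
have /cauchy_exP/cauchy_cvg : cauchy_ex (u @ \oo).
  move=> e e0; have [N uN] := cu e e0.
  exists (u N); exists N => // i Ni /=.
  by rewrite -ball_normE /=; exact: uN.
move=> /cvg_ex[/= x ux]; exists x => e e0.
move/cvgrPdist_lt : ux => /(_ e e0)[N _ uN].
by exists N => i Ni; rewrite distrC; exact: uN.
Qed.

Lemma continuous_linear_bound (X Y : normedModType R) (T : {linear X -> Y}) :
  continuous T -> exists2 K : R, 0 <= K & forall x, `|T x| <= K * `|x|.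
Proof.
move=> cT; have /linear_boundedP/pinfty_ex_gt0[K K0 TK] :=
  continuous_linear_bounded 0 (cT 0).
by exists K; [exact: ltW|].
Qed.

(** By Baire's theorem, the closure of the image of some ball contains a ball around some [y0].
    Subtracting approximations of two of its points moves this ball to the origin. *)
Lemma almost_open_mapping X Y (T : {linear X -> Y}) : (forall z, exists x, T x = z) ->
  exists2 C : R, 0 <= C & forall z, exists x, `|x| <= C * `|z| /\ `|z - T x| <= `|z| / 2.
Proof.
move=> surjT.
pose B n := closure [set T x | x in [set x : X | `|x| <= n%:R]].
have [n nd] : exists n, ~ dense (~` B n).
  apply/existsNP => H.
  have /Baire dB : forall n, open (~` B n) /\ dense (~` B n).
    by move=> n; split=> //; apply: closed_openC; exact: closed_closure.
  have [||y [_ yB]] := dB setT; [by exists 0|exact: openT|].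
  have [x xy] := surjT y; apply: (yB (Num.truncn `|x|).+1) => //.
  apply: subset_closure; exists x => //=.
  by rewrite ltW// truncnS_gt.
have [W [[y0 [Wo Wy0]] WB]] := denseNE nd.
have [r /= r0 rW] : nbhs_ball y0 W by apply/nbhs_ballP; exact: open_nbhs_nbhs.
have inB y : `|y0 - y| < r -> B n y.
  move=> yr; apply: contrapT => nBy.
  suff : (W `&` ~` B n) y by rewrite WB.
  by split=> //; apply: rW; rewrite -ball_normE.
have apx y e : `|y0 - y| < r -> 0 < e -> exists2 x, `|x| <= n%:R & `|y - T x| < e.
  move=> /inB By e0.
  have [_ [[x /= xn <-]]] := By _ (nbhsx_ballx y e e0).
  by rewrite -ball_normE /=; exists x.
exists (4 * n%:R / r); first by rewrite divr_ge0 ?(ltW r0)// mulr_ge0.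
move=> z; have [->|z0] := eqVneq z 0.
  by exists 0; rewrite linear0 subrr !normr0 mulr0 mul0r.
have nz : 0 < `|z| by rewrite normr_gt0.
pose a := r / 2 / `|z|; have a0 : 0 < a by rewrite !divr_gt0.
have az : `|a *: z| = r / 2 by rewrite normrZ gtr0_norm// divfK// lt0r_neq0.
(* The scalar [a] gives [a *: z] norm [r / 2]; [x1] and [x2] approximate [y0 + a *: z] and [y0],
   with total error at most [r / 4]. *)
have [||x1 x1n x1e] := apx (y0 + a *: z) (r / 8); [|by lra|].
  by rewrite opprD addrA subrr add0r normrN az; lra.
have [||x2 x2n x2e] := apx y0 (r / 8); [by rewrite subrr normr0|by lra|].
exists (a^-1 *: (x1 - x2)).
have x12 : `|x1 - x2| <= 2 * n%:R by have := ler_normB x1 x2; lra.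
have aE : a^-1 = 2 / r * `|z| by rewrite /a; field; rewrite !lt0r_neq0.
split.
  rewrite normrZ gtr0_norm ?invr_gt0// aE.
  have -> : 4 * n%:R / r * `|z| = 2 / r * `|z| * (2 * n%:R) by ring.
  by rewrite ler_wpM2l// mulr_ge0// divr_ge0 ?(ltW r0).
rewrite linearZ/= linearB/= -[z in z - _](scalerK (lt0r_neq0 a0)) -scalerBr.
rewrite normrZ gtr0_norm ?invr_gt0//.
have -> : a *: z - (T x1 - T x2) = (y0 + a *: z - T x1) - (y0 - T x2).
  rewrite !opprB -[y0 + _ - _]addrA [y0 + _]addrC -[RHS]addrA [y0 + _]addrC subrK.
  by rewrite addrA addrAC.
have : `|y0 + a *: z - T x1 - (y0 - T x2)| <= r / 4.
  by apply: le_trans (ler_normB _ _) _; lra.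
rewrite aE => h; rewrite -[leRHS]mulrC.
have -> : 2^-1 * `|z| = 2 / r * `|z| * (r / 4).
  by field; rewrite lt0r_neq0.
by rewrite ler_wpM2l// mulr_ge0// divr_ge0 ?(ltW r0).
Qed.

(** Each correction has norm at most [C] times the residual and halves it. Balls of radius
    [2 * C + 1] times the residual are thus nested, because [C + (2 * C + 1) / 2 <= 2 * C + 1], and
    the residual vanishes at the limit. *)
Theorem open_mapping X Y (T : {linear X -> Y}) : continuous T ->
  (forall z, exists x, T x = z) ->
  exists2 C : R, 0 <= C & forall z, exists2 x, T x = z & `|x| <= C * `|z|.
Proof.
move=> cT surjT; have [C C0 CP] := almost_open_mapping surjT.
have [K K0 TK] := continuous_linear_bound cT.
exists (2 * C + 1); first lra.
move=> z; pose rad x := (2 * C + 1) * `|z - T x|.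
have rad0 x : 0 <= rad x by rewrite mulr_ge0//; lra.
have [|//||y [y0 yP]] := @nested_balls R X _ (norm_seminorm X) (@norm_complete X)
    X id rad (fun=> True) (fun _ _ => True) 0.
- by [].
- move=> k x _; have [x' [x'C x'z]] := CP (z - T x).
  exists (x + x'); rewrite /rad addrAC subrr add0r linearD opprD addrA.
  have h : (2 * C + 1) * `|z - T x - T x'| <= (2 * C + 1) * (`|z - T x| / 2).
    by rewrite ler_wpM2l//; lra.
  by split=> //; have := normr_ge0 (z - T x); lra.
exists y; last first.
  by move: y0; rewrite /rad /= (linear0 T) !subr0.
apply/eqP; rewrite -subr_eq0 -normr_eq0 eq_le normr_ge0 andbT.
apply/ler_addgt0Pr => e e0; rewrite add0r.
pose k := Num.truncn ((K + 1) * rad 0 / e).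
have [x [_ _ yx radx]] := yP k.
have zx : `|z - T x| <= rad x.
  by rewrite /rad ler_peMl//; lra.
have : `|T y - z| <= (K + 1) * rad x.
  have -> : T y - z = T (y - x) - (z - T x) by rewrite linearB opprB addrA subrK.
  apply: le_trans (ler_normB _ _) _; rewrite mulrDl mul1r lerD//.
  by apply: le_trans (TK _) _; rewrite ler_wpM2l.
move=> /le_trans; apply.
apply: le_trans (_ : (K + 1) * (rad 0 / 2 ^+ k.+1) <= _).
  by rewrite ler_wpM2l//; lra.
rewrite mulrA ler_pdivrMr ?exprn_gt0// -ler_pdivrMl// ltW// mulrC.
apply: lt_trans (truncnS_gt _) _.
by rewrite -natrX ltr_nat ltn_expl.
Qed.

End open_mapping.

(** * Quojections *)

Lemma cvg_prod_topology (T : nat -> topologicalType) (F : set_system (prod_topology T))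
    (t : prod_topology T) : Filter F ->
  (forall i W, nbhs (t i) W -> F [set s | W (s i)]) -> F --> t.
Proof.
move=> FF H; apply/cvg_sup => i A.
rewrite (@nbhsE (initial_topology (fun f : (forall i, T i) => f i))).
move=> [B [[W oW WB] Bt] BA].
have Wt : W (t i) by move: Bt; rewrite -WB.
have := H i W (open_nbhs_nbhs (conj oW Wt)).
by apply: filterS => s Ws; apply: BA; rewrite -WB.
Qed.

(* The seminorms of the Banach spaces of which E is the strict projective limit;
   the last item lifts the unit ball of the n-th one to a bounded set of E. *)
Record strict_grading (R : realType) (E : tvsType R) (p : nat -> E -> R) :
    Prop := StrictGrading {
  grading_seminorm : forall n, seminorm (p n);
  grading_nbhs : forall x U, nbhs x U <->
    exists n r, 0 < r /\ sball (p n) x r `<=` U;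
  grading_complete : forall n, seminorm_complete (p n);
  grading_le : forall m n, (m <= n)%N ->
    exists2 C : R, 0 <= C & forall x, p m x <= C * p n x;
  grading_lift : forall n, exists C : nat -> R, (forall m, 0 <= C m) /\
    forall x, exists y, p n (y - x) = 0 /\ forall m, p m y <= C m * p n x }.

(** * Lifting along the projective spectrum *)

Section quojection_grading.
Context {R : realType} (En : nat -> completeNormedModType R).
Context (P : forall n m, {linear En m -> En n}).
Hypotheses (Pspec : projective_spectrum P) (Pstrict : strict_projective_limit P).

Let P_bound n m : (n <= m)%N ->
  exists2 K : R, 0 <= K & forall x, `|P n m x| <= K * `|x|.
Proof. by case: Pspec => cP _ _ nm; apply: continuous_linear_bound; exact: cP. Qed.

(** Threads of the limit through a given [z] show that [P m m.+1] is onto. The right inverse given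
    by the open mapping theorem is norm-bounded, with no linearity claimed. *)
Let section_exists m : exists Ch : R * (En m -> En m.+1), 0 <= Ch.1 /\
  forall z, P m m.+1 (Ch.2 z) = z /\ `|Ch.2 z| <= Ch.1 * `|z|.
Proof.
have [cP _ _] := Pspec.
have [z|C C0 CP] := open_mapping (cP _ _ (leqnSn m)).
  have [w wlim wz] := @Pstrict m z I.
  by exists (w m.+1); rewrite (wlim _ _ (leqnSn m)).
have /choice[h hP] : forall z, exists x, P m m.+1 x = z /\ `|x| <= C * `|z|.
  by move=> z; have [x ? ?] := CP z; exists x.
by exists (C, h).
Qed.

(** Coordinates up to [n] are the images of [z]; later ones are obtained by successive lifts, whose
    constants multiply. *)
Lemma projective_limit_lift n : exists C : nat -> R, (forall m, 0 <= C m) /\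
  forall z : En n, exists w, [/\ projective_limit P w, w n = z &
    forall m, `|w m| <= C m * `|z|].
Proof.
have [cP Pid Pcomp] := Pspec.
pose K m := (sval (cid (section_exists m))).1.
pose h m := (sval (cid (section_exists m))).2.
have K0 m : 0 <= K m by have [] := svalP (cid (section_exists m)).
have hP m z : P m m.+1 (h m z) = z /\ `|h m z| <= K m * `|z|.
  by have [_ H] := svalP (cid (section_exists m)); exact: H.
pose w (z : En n) := fix w m : En m := match m with
  | 0%N => P 0%N n z
  | k.+1 => if (k.+1 <= n)%N then P k.+1 n z else h k (w k)
  end.
have wle z m : (m <= n)%N -> w z m = P m n z.
  by case: m => [//|m] mn /=; rewrite mn.
have wS z m : P m m.+1 (w z m.+1) = w z m.
  rewrite /=; case: ifPn => [mn|_]; last exact: (hP _ _).1.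
  by rewrite Pcomp// wle// ltnW.
have wlim z : projective_limit P (w z).
  move=> i j; elim: j => [|j IH]; first by rewrite leqn0 => /eqP ->; rewrite Pid.
  rewrite leq_eqVlt => /predU1P[->|]; first by rewrite Pid.
  by rewrite ltnS => ij; rewrite -(Pcomp i j j.+1)// wS IH.
have /choice[C CP] : forall m, exists C : R, 0 <= C /\ forall z, `|w z m| <= C * `|z|.
  elim=> [|m [C [C0 CP]]].
    by have [C C0 CP] := P_bound (leq0n n); exists C.
  have [mn|mn] := leqP m.+1 n.
    by have [C' C'0 C'P] := P_bound mn; exists C'; split=> // z; rewrite wle.
  exists (K m * C); split=> [|z]; first exact: mulr_ge0.
  rewrite /= leqNgt mn/=; apply: le_trans (hP _ _).2 _.
  by rewrite -mulrA ler_wpM2l.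
exists C; split=> [m|z]; first by have [] := CP m.
exists (w z); split=> //; first by rewrite wle// Pid.
by move=> m; have [_] := CP m.
Qed.

End quojection_grading.

Lemma quojection_strict_grading (R : realType) (E : tvsType R) :
  quojection E -> exists p : nat -> E -> R, strict_grading p.
Proof.
move=> [_ [En [P [J [Pspec Pstrict Jlin [cJ [g [Jg Jlim gJ cg]]]]]]]].
have [cP _ _] := Pspec.
have Jp x : projective_limit P (J x) by apply: Jlim; exists x.
pose p n x := `|J x n|.
have JB n x y : J (x - y) n = J x n - J y n.
  by rewrite [x - y]addrC -[- y]scaleN1r Jlin scaleN1r addrC.
have spn n : seminorm (p n).
  split=> [x y|a x]; rewrite /p.
    by rewrite -[x]scale1r Jlin !scale1r; exact: ler_normD.
  have J0 : J 0 n = 0 by rewrite -(subrr 0) JB subrr.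
  by rewrite -[a *: x]addr0 Jlin J0 addr0 normrZ.
have ple m n : (m <= n)%N -> exists2 C : R, 0 <= C & forall x, p m x <= C * p n x.
  move=> mn; have [C C0 CP] := continuous_linear_bound (cP _ _ mn).
  by exists C => // x; rewrite /p -(Jp x _ _ mn).
exists p; split=> //.
- move=> x U; split; last first.
    move=> [n [r [r0 rU]]]; apply: filterS rU _.
    have /cvgrPdist_lt/(_ r r0) : (fun y => J y n) @ x --> J x n.
      apply: (@continuous_comp _ _ _ J (@proj _ (fun n => En n) n)); first exact: cJ.
      exact: (@proj_continuous _ (fun n => En n : topologicalType)).
    by apply: filterS => y; rewrite /sball/= /p JB distrC.
  move=> Ux.
  (* [F] is generated by the seminorm balls at [x]. Since [g] is continuous on the limit, it
     suffices that the image of [F] under [J] converges to [J x], which is checked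
     coordinatewise. *)
  pose F : set_system E := [set A | exists n r, 0 < r /\ sball (p n) x r `<=` A].
  have FF : Filter F.
    split.
    - by exists 0%N, 1; split.
    - move=> A B [n [r [r0 rA]]] [m [s [s0 sB]]].
      have [C C0 CP] := ple n (maxn n m) (leq_maxl _ _).
      have [C' C'0 C'P] := ple m (maxn n m) (leq_maxr _ _).
      pose t := Num.min (r / (C + 1)) (s / (C' + 1)).
      exists (maxn n m), t; split.
        by rewrite lt_min !divr_gt0//; lra.
      have t1 : t <= r / (C + 1) by rewrite ge_min lexx.
      have t2 : t <= s / (C' + 1) by rewrite ge_min lexx orbT.
      move: t1 t2; rewrite !ler_pdivlMr; [|lra|lra] => t1 t2.
      move=> y; rewrite /sball/= => yt.
      have y0 := seminorm_ge0 (y - x) (spn (maxn n m)).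
      split; [apply: rA|apply: sB]; rewrite /sball/=.
        apply: le_lt_trans (CP _) _.
        have := ler_wpM2l C0 (ltW yt); nra.
      apply: le_lt_trans (C'P _) _.
      have := ler_wpM2l C'0 (ltW yt); nra.
    - by move=> A B AB [n [r [r0 rA]]]; exists n, r; split=> //; exact: subset_trans AB.
  have JF : J @ F --> J x.
    apply: cvg_prod_topology => n W /nbhs_normP[r /= r0 rW].
    exists n, r; split=> // y; rewrite /sball/= /p JB => yr.
    by apply: rW; rewrite /= distrC.
  have Ugx : nbhs (g (J x)) U by rewrite Jg.
  have /JF := (subspace_continuousP _ _).1 cg (J x) (Jp x) U Ugx.
  move=> [n [r [r0 rU]]]; exists n, r; split=> // y /rU /=.
  by move=> /(_ (Jp y)); rewrite -{2}(Jg y).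
- move=> n u cu.
  have [|z zP] := @norm_complete R (En n) (fun i => J (u i) n).
    move=> e e0; have [N uN] := cu e e0.
    by exists N => i j Ni Nj; rewrite -JB; exact: uN.
  (* By strictness, the limit found in [En n] is the [n]-th coordinate of a point of [E]. *)
  have [w wlim wz] := @Pstrict n z I.
  exists (g w) => e e0; have [N zN] := zP e e0.
  by exists N => i Ni; rewrite /p JB gJ// wz; exact: zN.
- move=> n; have [C [C0 CP]] := projective_limit_lift Pspec Pstrict n.
  exists C; split=> // x; have [w [wlim wx wC]] := CP (J x n).
  exists (g w); split; first by rewrite /p JB gJ// wx subrr normr0.
  by move=> m; rewrite /p gJ.
Qed.

(** * Reflexivity *)

Section strong_dual_lemmas.
Context {R : realType} {E : tvsType R}.
Implicit Types (f g : strong_dual E) (x y : E) (S : set E) (a r : R).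

Lemma dual_funD f g x : (f + g) x = f x + g x.
Proof. by []. Qed.

Lemma dual_funB f g x : (f - g) x = f x - g x.
Proof. by []. Qed.

Lemma dual_funZ a f x : (a *: f) x = a * f x.
Proof. by []. Qed.

Lemma dual_fun_linear f : linear f.
Proof. by have /asboolP[] := dual_funP f. Qed.

Lemma dual_fun_continuous f : continuous f.
Proof. by have /asboolP[] := dual_funP f. Qed.

(* The supremum is taken over a set containing 0, to cover the empty S *)
Definition dual_sup S f : R := sup [set r | r = 0 \/ exists2 x, S x & r = `|f x|].

Lemma dual_sup_le S f r : 0 <= r -> (forall x, S x -> `|f x| <= r) ->
  dual_sup S f <= r.
Proof.
move=> r0 H; apply: sup_le_ub; first by exists 0; left.
by move=> _ [->//|[x Sx ->]]; exact: H.
Qed.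

Section bounded_dual.
Variable S : set E.
Hypothesis Sb : forall f, exists M, forall x, S x -> `|f x| <= M.

Lemma le_dual_sup f x : S x -> `|f x| <= dual_sup S f.
Proof.
move=> Sx; apply: ub_le_sup; last by right; exists x.
have [M SM] := Sb f.
by exists `|M| => _ [->//|[y Sy ->]]; exact: le_trans (SM _ Sy) (ler_norm _).
Qed.

Lemma dual_sup_ge0 f : 0 <= dual_sup S f.
Proof.
apply: ub_le_sup; last by left.
have [M SM] := Sb f.
by exists `|M| => _ [->//|[y Sy ->]]; exact: le_trans (SM _ Sy) (ler_norm _).
Qed.

Lemma dual_sup_seminorm : seminorm (dual_sup S).
Proof.
have Zle a f : dual_sup S (a *: f) <= `|a| * dual_sup S f.
  apply: dual_sup_le => [|x Sx]; first by rewrite mulr_ge0// dual_sup_ge0.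
  by rewrite dual_funZ normrM ler_wpM2l// le_dual_sup.
split=> [f g|a f].
  apply: dual_sup_le => [|x Sx]; first by rewrite addr_ge0// dual_sup_ge0.
  by rewrite dual_funD; apply: le_trans (ler_normD _ _) _; rewrite lerD// le_dual_sup.
apply/eqP; rewrite eq_le Zle/=.
have [->|a0] := eqVneq a 0; first by rewrite normr0 mul0r dual_sup_ge0.
rewrite -ler_pdivlMl ?normr_gt0// -normfV.
by have := Zle a^-1 (a *: f); rewrite scalerK.
Qed.

End bounded_dual.

Lemma nbhs_dual_sup S f r : tvs_bounded S -> 0 < r ->
  nbhs f [set g | forall x, S x -> `|f x - g x| < r].
Proof.
move=> bS r0.
have fcvg : {family @tvs_bounded R E,
    (@dual_fun R E) @ nbhs f --> (f : E -> R^o)}.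
  exact: (@initial_continuous _ _
    (@dual_fun R E : strong_dual E -> {family @tvs_bounded R E, E -> R^o})).
have [+ _] := @fam_cvgP E R^o (@tvs_bounded R E) _ (f : E -> R^o)
  (fmap_filter (@dual_fun R E) (nbhs_filter f)).
move=> /(_ fcvg _ bS); apply.
apply/uniform_nbhs; exists [set ab | `|ab.1 - ab.2| < r]; split; last by [].
by rewrite -entourage_ballE; exists r => //= ab; rewrite /= -ball_normE.
Qed.

Lemma bidual_continuous S (phi : strong_dual E -> R^o) : tvs_bounded S ->
  (forall f, exists M, forall x, S x -> `|f x| <= M) ->
  linear phi -> (forall f, phi f <= dual_sup S f) -> continuous phi.
Proof.
move=> bS Sb lphi phiS f; have FF : Filter (nbhs f) by exact: nbhs_filter.
apply/(@cvgrPdist_lt _ _ _ _ FF) => e e0.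
have e2 : 0 < e / 2 by lra.
have := nbhs_dual_sup f bS e2; apply: filterS => g fg.
have [_ _ _ _ phiB] := linear_form_zmod lphi.
rewrite -phiB; apply: le_lt_trans (_ : e / 2 < e); last by lra.
apply: le_trans (linear_le_seminorm _ (dual_sup_seminorm Sb) lphi phiS) _.
by apply: dual_sup_le => [|x Sx]; [exact: ltW|rewrite dual_funB ltW// fg].
Qed.

End strong_dual_lemmas.

(** * Duality on a graded space *)

Section graded.
Context {R : realType} {E : tvsType R} (p : nat -> E -> R).
Hypothesis gp : strict_grading p.
Let sp n : seminorm (p n) := grading_seminorm gp n.

Lemma nbhs_sball n x (r : R) : 0 < r -> nbhs x (sball (p n) x r).
Proof. by move=> r0; apply/(grading_nbhs gp); exists n, r; split. Qed.

Lemma bounded_linear_dual n (psi : E -> R^o) (K : R) : linear psi ->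
  (forall v, psi v <= K * p n v) -> exists f : strong_dual E, dual_fun f = psi.
Proof.
move=> lpsi psiK; have [_ _ N _ B] := linear_form_zmod lpsi.
suff cpsi : continuous psi.
  by exists (StrongDual (asboolT (conj lpsi cpsi))).
have psiK' v : `|psi v| <= `|K| * p n v.
  have Kp : K * p n v <= `|K| * p n v.
    by rewrite ler_wpM2r ?ler_norm// seminorm_ge0.
  rewrite ler_norml; apply/andP; split; last exact: le_trans (psiK v) Kp.
  by have := psiK (- v); rewrite N (seminormN _ (sp n)); lra.
move=> x; apply/cvgrPdist_lt => e e0.
have K1 : 0 < `|K| + 1 by rewrite ltr_wpDl.
have : 0 < e / (`|K| + 1) by rewrite divr_gt0.
move=> /(nbhs_sball n x); apply: filterS => y; rewrite /sball/= => yx.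
rewrite -B; apply: le_lt_trans (psiK' _) _; rewrite (seminorm_distC _ _ (sp n)).
apply: le_lt_trans (_ : (`|K| + 1) * p n (y - x) < e).
  by rewrite ler_wpM2r ?seminorm_ge0// lerDl.
by rewrite -ltr_pdivlMl// mulrC.
Qed.

Lemma dual_le_seminorm (f : strong_dual E) :
  exists n (C : R), 0 <= C /\ forall v, `|f v| <= C * p n v.
Proof.
have [_ Z _ f0 _] := linear_form_zmod (dual_fun_linear f).
have cf : {for 0, continuous f} by exact: dual_fun_continuous.
have /cvgrPdist_lt/(_ 1 ltr01) := cf.
move=> /(grading_nbhs gp)[n [r [r0 rf]]]; exists n, (2 / r).
split=> [|v]; first by rewrite divr_ge0// ltW.
apply/ler_addgt0Pr => e e0.
have pv := seminorm_ge0 v (sp n).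
(* A positive substitute for [p n v], used to rescale [v] into the ball; its excess becomes the
   error [e] after multiplication by [2 / r]. *)
pose s := p n v + e * r / 2.
have er : 0 < e * r / 2 by rewrite divr_gt0// mulr_gt0.
have s0 : 0 < s by rewrite /s; lra.
have : sball (p n) 0 r ((r / 2 / s) *: v).
  rewrite /sball/= subr0 (sp n).2 gtr0_norm ?divr_gt0//.
  by rewrite mulrAC ltr_pdivrMr// /s; nra.
move=> /rf /=; rewrite f0 sub0r normrN Z normrM gtr0_norm ?divr_gt0//.
rewrite -ltr_pdivlMl ?divr_gt0// mulr1 => /ltW/le_trans; apply.
rewrite invf_div /s invf_div.
have -> : (p n v + e * r / 2) * (2 / r) = 2 / r * p n v + e.
  by field; rewrite lt0r_neq0.
exact: lexx.
Qed.

Lemma graded_boundedP S : tvs_bounded S <->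
  forall n, exists M : R, forall x, S x -> p n x <= M.
Proof.
split=> [bS n|H U /(grading_nbhs gp)[n [r [r0 rU]]]].
  have := bS _ (nbhs_sball n 0 ltr01) => bS1.
  have [t [t0 St]] : exists t : R, 0 < t /\ S `<=` [set t *: x | x in sball (p n) 0 1].
    near (pinfty_nbhs R) => t; exists t; split; near: t; last exact: bS1.
    by apply: nbhs_pinfty_gt; exact: num_real.
  exists t => x /St[y y1 <-]; rewrite (sp n).2 gtr0_norm//.
  by move: y1; rewrite /sball/= subr0 => y1; rewrite ger_pMr// ltW.
have [M SM] := H n.
near=> t => x Sx.
have t0 : 0 < t by near: t; apply: nbhs_pinfty_gt; exact: num_real.
exists (t^-1 *: x); last by rewrite scalerA divff ?scale1r// gt_eqF.
apply: rU; rewrite /sball/= subr0 (sp n).2 gtr0_norm ?invr_gt0//.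
rewrite mulrC ltr_pdivrMr//; apply: le_lt_trans (SM _ Sx) _.
rewrite -ltr_pdivrMl// mulrC.
by near: t; apply: nbhs_pinfty_gt; exact: num_real.
Unshelve. all: by end_near. Qed.

Lemma dual_bounded_on S (f : strong_dual E) : tvs_bounded S ->
  exists M, forall x, S x -> `|f x| <= M.
Proof.
move=> /graded_boundedP bS; have [n [C [C0 fC]]] := dual_le_seminorm f.
have [M SM] := bS n; exists (C * M) => x Sx.
by apply: le_trans (fC x) _; rewrite ler_wpM2l// SM.
Qed.

(** The [e i] are lifted to a bounded set [S], so [dual_sup S] measures uniform approximation on
    them and forms dominated by it belong to the bidual. The approximants are rational combinations
    of functionals [v] norming the rational combinations of the lifts. *)
Lemma reflexive_countably_approximable n :
  reflexive_lcs E -> countably_approximable (p n).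
Proof.
move=> [_ [ev [_ _ evK _]]] I e e1.
have [C [C0 CP]] := grading_lift gp n.
have /choice[s sP] : forall i, exists y, p n (y - e i) = 0 /\
    forall m, p m y <= C m.
  move=> i; have [y [y0 yC]] := CP (e i); exists y; split=> // m.
  by apply: le_trans (yC m) _; rewrite ler_piMr.
pose S := range s.
have bS : tvs_bounded S.
  by apply/graded_boundedP => m; exists (C m) => _ [i _ <-]; exact: (sP i).2.
have Sb (f : strong_dual E) : exists M, forall x, S x -> `|f x| <= M.
  exact: dual_bounded_on.
have sup_s := dual_sup_seminorm Sb.
have /choice[v vP] : forall ml : nat * seq (rat * I), exists f : strong_dual E,
    (forall x, `|f x| <= p ml.1 x) /\ f (rat_comb s ml.2) = p ml.1 (rat_comb s ml.2).
  move=> [m l] /=.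
  have [psi [lpsi psip psil]] := seminorm_norming (rat_comb s l) (sp m).
  have [|f fE] := bounded_linear_dual (n := m) (K := 1) lpsi.
    by move=> x; rewrite mul1r; apply: le_trans (psip x); exact: ler_norm.
  by exists f; rewrite fE.
(* Indices that code no combination get the value 0. *)
pose ck k i : R := if (unpickle k : option (seq (rat * (nat * seq (rat * I))))) is Some l
  then (rat_comb v l) (s i) else 0.
exists ck => psi K lpsi psiK eps eps0.
have [f fE] := bounded_linear_dual lpsi psiK.
have [l lP] : exists l, dual_sup S (f - rat_comb v l) < eps.
  apply: rat_comb_dense => // phi lphi phiS phiv.
  have cphi := bidual_continuous bS Sb lphi phiS.
  pose Phi : strong_dual (strong_dual E) := StrongDual (asboolT (conj lphi cphi)).
  have evP g : phi g = g (ev Phi).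
    by have := evK Phi Logic.I => /(congr1 (fun F : strong_dual (strong_dual E) => F g)).
  set x := ev Phi in evP.
  (* [x] lies in the closed span of the lifts: a functional that vanishes on [S] has [dual_sup S]
     equal to 0, so [phi], its evaluation at [x], is 0. *)
  have xS m r : 0 < r -> exists l, p m (x - rat_comb s l) < r.
    apply: rat_comb_dense => // psi' lpsi' psi'p psi's.
    have [|g gE] := bounded_linear_dual (n := m) (K := 1) lpsi'.
      by move=> y; rewrite mul1r.
    rewrite -gE -evP; apply/eqP; rewrite -normr_eq0 eq_le normr_ge0 andbT.
    apply: le_trans (linear_le_seminorm _ sup_s lphi phiS) _.
    by apply: dual_sup_le => // _ [i _ <-]; rewrite gE psi's normr0.
  (* For a combination [y] of the lifts near [x], its norming functional is 0 at [x] and [p m y] at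
     [y]. Hence [p m y <= p m (x - y)], and [p m x <= 2 * p m (x - y)]. *)
  have x0 m : p m x = 0.
    apply/eqP; rewrite eq_le seminorm_ge0 ?andbT//.
    apply/ler_addgt0Pr => r r0; rewrite add0r.
    have [l lx] := xS m (r / 2) ltac:(lra).
    have [vp vl] := vP (m, l).
    have [_ _ _ _ vB] := linear_form_zmod (dual_fun_linear (v (m, l))).
    have := vp (x - rat_comb s l); rewrite vB -evP phiv vl sub0r normrN /= => h.
    have := (sp m).1 (x - rat_comb s l) (rat_comb s l); rewrite subrK.
    by have := ler_norm (p m (rat_comb s l)); lra.
  rewrite evP; have [m [D [D0 fD]]] := dual_le_seminorm f.
  by apply/eqP; rewrite -normr_le0; apply: le_trans (fD x) _; rewrite x0 mulr0.
exists (pickle l) => i; rewrite /ck pickleK.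
(* [psi] is dominated by a multiple of [p n], which does not separate [e i] from its lift. *)
have psis : psi (e i) = f (s i).
  have [_ _ N _ B] := linear_form_zmod lpsi.
  rewrite fE; apply/eqP; rewrite -subr_eq0 eq_le -B.
  have pe := (sP i).1.
  have pe' : p n (e i - s i) = 0 by rewrite (seminorm_distC _ _ (sp n)).
  apply/andP; split; first by apply: le_trans (psiK _) _; rewrite pe' mulr0.
  rewrite -oppr_le0 -N opprB.
  by apply: le_trans (psiK _) _; rewrite pe mulr0.
rewrite psis -dual_funB ltW//; apply: le_lt_trans lP.
by apply: le_dual_sup => //; exists i.
Qed.

End graded.

(** * Differentiability *)

Section convex_on_grading.
Context {R : realType} {E : tvsType R} (p : nat -> E -> R).
Hypothesis gp : strict_grading p.
Let sp n : seminorm (p n) := grading_seminorm gp n.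
Context (D : set E) (f : E -> R^o).
Hypotheses (oD : open D) (cf : {within D, continuous f}) (cvf : convex_on D f).

(* Near these points f factors through the n-th Banach space. *)
Definition level n : set E := [set x | exists r M, 0 < r /\
  forall y, sball (p n) x r y -> D y /\ f y <= M].

(* Pairwise disjoint open sets with dense union in D: a point that is almost
   smooth to every order must be so with respect to the same seminorm. *)
Definition layer n : set E := level n `\` closure (\bigcup_(i in `I_n) level i).

Definition almost_smooth n k : set E := [set x | exists2 d, 0 < d &
  forall e, p n e <= 1 -> [/\ D (x + d *: e), D (x - d *: e) &
    second_diff f x (d *: e) <= k.+1%:R^-1 * d]].

Lemma level_sub n : level n `<=` D.
Proof.
move=> x [r [M [r0 rM]]]; have [] // := rM x.
by rewrite /sball/= subrr seminorm0.
Qed.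

Lemma level_open n : open (level n).
Proof.
rewrite openE => x [r [M [r0 rM]]]; apply/(grading_nbhs gp).
exists n, (r / 2); split=> [|y]; first lra.
rewrite /sball/= => yx; exists (r / 2), M; split=> [|z]; first lra.
rewrite /sball/= => zy; apply: rM; rewrite /sball/=.
have := seminorm_triangle z y x (sp n); lra.
Qed.

Lemma level_cover x : D x -> exists n, level n x.
Proof.
move=> Dx; have nD : nbhs x D by apply: open_nbhs_nbhs.
have cfx : {for x, continuous f}.
  by move: cf; rewrite continuous_open_subspace// => /(_ x); apply; rewrite inE.
have /cvgrPdist_lt/(_ 1 ltr01) n1 := cfx.
have [n [r [r0 rU]]] := (grading_nbhs gp _ _).1 (filterI nD n1).
exists n, r, (f x + 1); split=> // y /rU [Dy /=].
by rewrite ltr_norml => /andP[h _]; split=> //; lra.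
Qed.

Lemma layer_open n : open (layer n).
Proof.
apply: openI; first exact: level_open.
by apply: closed_openC; exact: closed_closure.
Qed.

Lemma layer_inj m n x : layer m x -> layer n x -> m = n.
Proof.
have H i j : layer i x -> layer j x -> ~ (i < j)%N.
  move=> [xi _] [_ xj] ij; apply: xj; apply: subset_closure.
  by exists i.
move=> xm xn; apply/eqP; rewrite eqn_leq; apply/andP.
by split; rewrite leqNgt; apply/negP; exact: H.
Qed.

(** For the least [n] whose level meets the open set [V], the earlier levels miss [V], and so does
    the closure of their union. *)
Lemma layer_dense V x : open V -> V x -> D x -> exists n, (V `&` layer n) !=set0.
Proof.
move=> oV Vx Dx.
pose hits n := `[< (V `&` level n) !=set0 >].
have ex : exists n, hits n.
  by have [n xn] := level_cover Dx; exists n; apply/asboolP; exists x.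
have := ex_minnP ex => -[n /asboolP[y [Vy yn]] min].
exists n, y; split=> //; split=> // /(_ V (open_nbhs_nbhs (conj oV Vy))).
move=> [z [[i /= ilt zi] Vz]].
have /min : hits i by apply/asboolP; exists z.
by rewrite leqNgt ilt.
Qed.

Lemma level_lipschitz n x : level n x -> exists r L, [/\ 0 < r, 0 <= L,
  sball (p n) x r `<=` D, convex_on (sball (p n) x r) f &
  lipschitz_on (p n) (sball (p n) x r) f L].
Proof.
move=> [r [M [r0 rM]]].
have sub : sball (p n) x r `<=` D by move=> y /rM[].
have cr : convex_on (sball (p n) x r) f.
  by move=> y z t yr zr; apply: cvf; exact: sub.
have [L L0 fL] := convex_bounded_lipschitz (sp n) r0 cr (fun y yr => (rM y yr).2).
have sub2 : sball (p n) x (r / 2) `<=` sball (p n) x r.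
  by move=> y; rewrite /sball/=; lra.
exists (r / 2), L; split=> //; first by lra.
- exact: subset_trans sub2 sub.
- by move=> y z t yr zr; apply: cr; exact: sub2.
Qed.

(** The union over [n] stands inside the intersection over [k], and interiors are taken, so that
    this is a countable intersection of open sets. *)
Definition smooth_set : set E :=
  \bigcap_k \bigcup_n (layer n `&` (almost_smooth n k)°).

Lemma smooth_set_Gdelta : Gdelta smooth_set.
Proof.
exists (fun k => \bigcup_n (layer n `&` (almost_smooth n k)°)) => // k.
apply: bigcup_open => n _; apply: openI; first exact: layer_open.
exact: open_interior.
Qed.

Lemma smooth_setP x : smooth_set x ->
  exists n, layer n x /\ forall k, almost_smooth n k x.
Proof.
move=> Gx; have [n _ [xn _]] := Gx 0%N I; exists n; split=> // k.
by have [m _ [xm /interior_subset]] := Gx k I; rewrite (layer_inj xn xm).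
Qed.

Lemma smooth_set_sub : smooth_set `<=` D.
Proof. by move=> x /smooth_setP[n [[xn _] _]]; exact: level_sub xn. Qed.

(** The smooth point [y0] is close to [x0] for [p n], while the target neighbourhood is measured by
    [p m]. Lifting [y0 - x0] with control of [p m] gives a point [y] of that neighbourhood at
    [p n]-distance 0 from [y0], where the same estimates hold. *)
Lemma smooth_set_dense : (forall n, countably_approximable (p n)) ->
  D `<=` closure smooth_set.
Proof.
move=> ap x Dx B xB.
have [||n [x0 [Vx0 nx0]]] := @layer_dense B° x _ _ Dx.
- exact: open_interior.
- exact: xB.
have [r [L [r0 L0 rD cr lr]]] := level_lipschitz nx0.1.
have : nbhs x0 (B° `&` layer n).
  by apply: open_nbhs_nbhs; split=> //; apply: openI; [exact: open_interior|exact: layer_open].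
move=> /(grading_nbhs gp)[m [s [s0 sV]]].
have [C [C0 CP]] := grading_lift gp n.
have Cm1 : 0 < C m + 1 by rewrite ltr_wpDl.
pose r' := Num.min r (s / (C m + 1)).
have r'0 : 0 < r' by rewrite lt_min r0 divr_gt0.
have r'r : r' <= r by rewrite ge_min lexx.
have r's : r' * (C m + 1) <= s by rewrite -ler_pdivlMr// ge_min lexx orbT.
have sub : sball (p n) x0 r' `<=` sball (p n) x0 r.
  by move=> y; rewrite /sball/=; lra.
have [y0 y0r y0P] := smooth_point_exists (sp n) (@grading_complete _ _ _ gp n) (@ap n) r'0 L0
  (fun y z t yU zU => cr y z t (sub _ yU) (sub _ zU))
  (fun y z yU zU => lr y z (sub _ yU) (sub _ zU)).
have [w [w0 wC]] := CP (y0 - x0).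
pose y := x0 + w.
have yy0 : p n (y - y0) = 0.
  by rewrite -w0 /y opprB addrA [w + x0]addrC.
have ym : sball (p m) x0 s y.
  rewrite /sball/= /y addrAC subrr add0r; apply: le_lt_trans (wC m) _.
  apply: le_lt_trans (_ : (C m + 1) * p n (y0 - x0) < s).
    by rewrite ler_wpM2r ?lerDl// seminorm_ge0.
  by apply: lt_le_trans r's; rewrite mulrC ltr_pM2r.
have [yB yn] := sV _ ym.
exists y; split; last exact: interior_subset.
move=> k _; exists n => //; split=> //.
have [rho [d [rho0 d0 dP]]] := y0P k.
apply/(grading_nbhs gp); exists n, rho; split=> // x'; rewrite /sball/= => x'y.
have [|x'd x'P] := dP x'.
  by have := seminorm_triangle x' y y0 (sp n); lra.
exists d => // e e1.
have pd : p n (d *: e) <= d by rewrite (sp n).2 gtr0_norm// ger_pMr.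
have inD v : p n v <= d -> D (x' + v).
  move=> vd; apply: rD; rewrite /sball/= addrAC.
  by have := (sp n).1 (x' - x0) v; lra.
by split; [exact: inD|apply: inD; rewrite (seminormN _ (sp n))|exact: x'P].
Qed.

(** Convexity passes an estimate at one scale [d] to all smaller increments. *)
Lemma second_diff_scale x w (t : R) : D x -> D (x + w) -> D (x - w) ->
  0 <= t -> t <= 1 -> second_diff f x (t *: w) <= t * second_diff f x w.
Proof.
move=> Dx Dxw Dxw' t0 t1.
have tx v : t *: (x + v) + (1 - t) *: x = x + t *: v.
  by rewrite scalerDr addrAC -scalerDl [t + _]addrC subrK scale1r.
have := cvf Dxw Dx t0 t1; have := cvf Dxw' Dx t0 t1.
by rewrite !tx scalerN /second_diff; lra.
Qed.

(** A subgradient [psi] at [x] is the derivative: [f (x + v) - f x - psi v] is nonnegative and, by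
    the subgradient inequality at [- v], at most the second difference. *)
Lemma smooth_set_differentiable x : smooth_set x -> frechet_differentiable f x.
Proof.
move=> /smooth_setP[n [[xn _] xk]].
have [r [L [r0 L0 rD cr lr]]] := level_lipschitz xn.
have xr : sball (p n) x r x by rewrite /sball/= subrr seminorm0.
have [psi [lpsi psiL psix]] := subgradient_exists (sp n) L0 cr lr xr.
have [x' x'E] := bounded_linear_dual gp lpsi psiL.
exists x' => B /(graded_boundedP gp)/(_ n)[M BM] Q /uniform_nbhs[U [entU UQ]].
apply: (filterS UQ) => /=; rewrite nbhs_simpl.
move: entU; rewrite -entourage_ballE => -[e /= e0 eU].
have M1 : 0 < `|M| + 1 by rewrite ltr_wpDl.
pose k := Num.truncn ((`|M| + 1) / e).
have ke : k.+1%:R^-1 * (`|M| + 1) < e.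
  by rewrite mulrC ltr_pdivrMr// -ltr_pdivrMl// mulrC truncnS_gt.
have [d d0 dP] := xk k.
have del0 : 0 < Num.min r d / (`|M| + 1) by rewrite divr_gt0// lt_min r0.
apply/nbhs_ballP; exists (Num.min r d / (`|M| + 1)) => //= t.
rewrite -ball_normE /= sub0r normrN ltr_pdivlMr// lt_min => /andP[tr td] tN0 y By.
apply: eU; rewrite /= -ball_normE /= x'E.
have [_ Z N _ _] := linear_form_zmod lpsi.
have nt : 0 < `|t| by rewrite normr_gt0.
have yM : p n y <= `|M| + 1.
  by apply: le_trans (BM _ By) _; apply: le_trans (ler_norm _) _; rewrite lerDl.
pose v := t *: y.
have vM : p n v <= `|t| * (`|M| + 1) by rewrite (sp n).2 ler_wpM2l.
pose l := `|t| * (`|M| + 1) / d.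
have l0 : 0 < l by rewrite divr_gt0// mulr_gt0.
have l1 : l <= 1 by rewrite ler_pdivrMr// mul1r ltW.
(* The increment [t *: y] is written as [l *: (d *: e')] with [e'] in the unit ball and [l <= 1];
   [|M| + 1] serves as a positive bound of [p n] on [B]. *)
pose e' := (t / (`|t| * (`|M| + 1))) *: y.
have e'1 : p n e' <= 1.
  rewrite (sp n).2 normrM normfV normrM normr_id (gtr0_norm M1).
  rewrite invfM mulrA divff ?lt0r_neq0// mul1r mulrC ler_pdivrMr// mul1r //.
have vE : v = l *: (d *: e').
  rewrite /v /e' /l !scalerA; congr (_ *: _); field.
  by rewrite !lt0r_neq0.
have [Dp Dm de] := dP e' e'1.
have sdv : second_diff f x v <= `|t| * (k.+1%:R^-1 * (`|M| + 1)).
  rewrite vE; apply: le_trans (second_diff_scale (level_sub xn) Dp Dm (ltW l0) l1) _.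
  apply: le_trans (ler_wpM2l (ltW l0) de) _.
  rewrite /l; set q := k.+1%:R^-1.
  suff -> : `|t| * (`|M| + 1) / d * (q * d) = `|t| * (q * (`|M| + 1)) by [].
  by field; rewrite lt0r_neq0.
have inr u : p n u <= `|t| * (`|M| + 1) -> sball (p n) x r (x + u).
  by move=> ut; rewrite /sball/= addrAC subrr add0r; lra.
have fp := psix v (inr _ vM).
have vM' : p n (- v) <= `|t| * (`|M| + 1) by rewrite (seminormN _ (sp n)).
have := psix (- v) (inr _ vM'); rewrite N => fm.
have psiv : psi y = psi v / t by rewrite Z mulrAC divff ?mul1r.
rewrite psiv -/v -mulrBl normrM normfV ltr_pdivrMr// distrC ger0_norm; last by lra.
apply: le_lt_trans (_ : `|t| * (k.+1%:R^-1 * (`|M| + 1)) < _).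
  have le_ab (a b c q z : R) : a + b - 2 * c <= z -> c - q <= b -> a - c - q <= z.
    by lra.
  exact: le_ab sdv fm.
by rewrite mulrC ltr_pM2r.
Qed.

End convex_on_grading.

Lemma convex_function_on (R : realType) (E : lmodType R) (D : set E) (f : E -> R^o) :
  convex_function D f -> convex_on D f.
Proof.
move=> cvf x y t Dx Dy t0 t1.
by have := cvf (Itv01 t0 t1) x y (mem_set Dx) (mem_set Dy).
Qed.

Theorem corollary6p3 (R : realType) (E : tvsType R) :
  quojection E -> reflexive_lcs E -> asplund E.
Proof.
move=> /quojection_strict_grading[p gp] reflE D f D0 oD _ cf /convex_function_on cvf.
have ap n := reflexive_countably_approximable gp (n := n) reflE.
exists (smooth_set p D f); split.
- exact: smooth_set_Gdelta.
- exact: smooth_set_sub.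
- exact: smooth_set_dense.
- exact: smooth_set_differentiable.
Qed.
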